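(* Let $\theta=(|\cdot|,\mathfrak s)\in\Theta_+\cup\Theta_-$. Let $d_\theta:\mathcal I^2\to\mathbb R_+$ be defined by $d_\theta(x,x')=\inf\{|u|+|u'|\ \mid\ (u,u')\in U_{\mathfrak s}(x,x')\}$ for $x,x'\in\mathcal I$. Then $d_\theta$ is a distance on $\mathcal I$.
   Context: **Vectorial data.** $I$ is a finite set and $C=(c_{i,j})_{i,j\in I}$ is a Kac--Moody matrix: $c_{i,j}\in\mathbb Z$, $c_{i,i}=2$, $c_{i,j}\le 0$ for $i\neq j$, and $c_{i,j}=0\iff c_{j,i}=0$. $X,Y$ are dual free $\mathbb Z$-modules of finite rank with $\mathbb Z$-linearly independent families $(\alpha_i)_{i\in I}$ in $X$ and $(\alpha_i^\vee)_{i\in I}$ in $Y$ such that $\alpha_j(\alpha_i^\vee)=c_{i,j}$. $\mathbb A=Y\otimes\mathbb R$, with its usual topology; elements of $X$ are linear forms on $\mathbb A$. $r_i(v)=v-\alpha_i(v)\alpha_i^\vee$, and $W^v=\langle r_i\mid i\in I\rangle\subset \mathrm{GL}(\mathbb A)$ (Weyl group), acting on $\mathbb A^*$ by $(w.\alpha)(x)=\alpha(w^{-1}x)$. $\Phi=\{w.\alpha_i\}$ is the set of real roots; for $\alpha=w.\alpha_i\in\Phi$, $\alpha^\vee=w.\alpha_i^\vee$. $Q^\vee=\bigoplus_i\mathbb Z\alpha_i^\vee$ and $W^a=Q^\vee\rtimes W^v$. $\Delta\subset\bigoplus_i\mathbb Z\alpha_i\subset\mathbb A^*$ is the set of all (real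 and imaginary) roots of the Kac--Moody algebra of $C$. For $\alpha\in\mathbb A^*$, $k\in\mathbb R$: $D(\alpha,k)=\{\alpha(x)+k\ge0\}$, $D^\circ(\alpha,k)=\{\alpha(x)+k>0\}$, $M(\alpha,k)=\{\alpha(x)+k=0\}$, and $D(\alpha,+\infty)=D^\circ(\alpha,+\infty)=\mathbb A$. Walls (resp. half-apartments) are the $M(\alpha,k)$ (resp. $D(\alpha,k)$), $\alpha\in\Phi$, $k\in\mathbb Z$. $C^v_f=\{v\mid\alpha_i(v)>0\ \forall i\}$; for $J\subset I$, $F^v(J)=\{v\mid \alpha_i(v)=0\ (i\in J),\ \alpha_i(v)>0\ (i\notin J)\}$. Positive (resp. negative) vectorial faces are the $w.F^v(J)$ (resp. $-w.F^v(J)$), $w\in W^v$; vectorial chambers are the $\pm w.C^v_f$. Tits cone: $\mathcal T=\bigcup_{w}w.\overline{C^v_f}$. A vectorial face is spherical if it meets $\pm\mathring{\mathcal T}$. $x\le y$ means $y-x\in\mathcal T$. A ray or segment through $x\ne y$ from $x$ is preordered if $x\le y$ or $y\le x$, generic if $y-x\in\pm\mathring{\mathcal T}$. **Filters.** A filter lies in a set $Z$ if $Z$ is an element of it; a set (e.g. an apartment) contains a filter if it contains an element of it; a map fixes a filter if it fixes pointwise some element of it. The support of a filter is the smallest affine subspace containing it. $\mathcal F\Cup\mathcal F'=\{E\cup E'\mid E\in\mathcal F,E'\in\mathcal F'\}$. The enclosure $\mathrm{cl}(\mathcal F)$ of a filter on $\mathbb A$ is the filter of sets $E$ containing some $\bigcap_{\alpha\in\Delta}D(\alpha,k_\alpha)\in\mathcal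 F$ with $k_\alpha\in\mathbb Z\cup\{+\infty\}$ (a set is treated as its principal filter). A sector-face is $f=x+F^v$ ($F^v$ a vectorial face); its germ at infinity is the filter of sets containing $x+u+F^v$ for some $u\in\overline{F^v}$. If $F^v$ is a vectorial chamber, $f$ is a sector and its germ is a sector-germ, with the sign of $F^v$; $\pm\infty$ is the germ of $\pm C^v_f$. The face $F(x,F^v)$ is the filter of sets $E$ for which there are $k_\alpha,k'_\alpha\in\mathbb Z\cup\{+\infty\}$ $(\alpha\in\Delta)$ and a neighbourhood $\Omega$ of $x$ with $E\supset\bigcap_{\alpha}(D(\alpha,k_\alpha)\cap D^\circ(\alpha,k'_\alpha))\supset\Omega\cap(x+F^v)$. A chamber (resp. panel) is a face with support $\mathbb A$ (resp. a wall). A chimney is $\mathfrak r(F,F^v)=\mathrm{cl}(F+F^v)$, $F$ a face, $F^v$ a vectorial face; it is splayed if $F^v$ is spherical, solid if the pointwise stabilizer in $W^v$ of the direction of its support is finite. Its germ is the filter of sets belonging to some $\mathfrak r(F+u,F^v)$, $u\in\overline{F^v}$. **Apartments.** $\mathrm{Aut}(\mathbb A)$ is the group of affine bijections of $\mathbb A$ stabilizing $\{(M(\alpha,k),\alpha^\vee)\mid\alpha\in\Phi,k\in\mathbb Z\}$. An apartment of type $\mathbb A$ is a set $A$ with a nonempty set $\mathrm{Isom}^w(\mathbb A,A)$ of bijections $\mathbb A\to A$ forming one orbit $f_0\circ W^a$. A bijection $\phi:A\to A'$ is a Weyl isomorphism (resp. an isomorphism, which here always means vectorially Weyl isomorphism)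 if $f'^{-1}\circ\phi\circ f\in W^a$ (resp. $\in(W^v\ltimes\mathbb A)\cap\mathrm{Aut}(\mathbb A)$) for $f\in\mathrm{Isom}^w(\mathbb A,A)$, $f'\in\mathrm{Isom}^w(\mathbb A,A')$. All above notions, the affine structure and the affine topology are transported to every apartment. **Masure.** A masure of type $\mathbb A$ is a set $\mathcal I$ covered by a family of subsets called apartments such that: (MA1) each apartment has a structure of apartment of type $\mathbb A$. (MA2) If $F$ is a point, a germ of a preordered interval, a generic ray or a solid chimney in an apartment $A$, and $A'$ is another apartment containing $F$, then $A\cap A'$ contains $\mathrm{cl}_A(F)$ and there is a Weyl isomorphism $A\to A'$ fixing $\mathrm{cl}_A(F)$. (MA3) If $\mathfrak R$ is the germ of a splayed chimney and $F$ is a face or a germ of a solid chimney, some apartment contains $\mathfrak R$ and $F$. (MA4) If apartments $A,A'$ contain $\mathfrak R$ and $F$ as in (MA3), there is a Weyl isomorphism $A\to A'$ fixing $\mathrm{cl}_A(\mathfrak R\Cup F)$. (MAO) If $x,y\in A\cap A'$ and $x\le_A y$ then $[x,y]_A=[x,y]_{A'}$. Standing assumptions: $\mathcal I$ is such a masure; each panel lies in the closure of finitely many, and more than $2$, chambers; a group $G$ acts strongly transitively on $\mathcal I$ (it permutes apartments, each $g:A\to g.A$ is an isomorphism of apartments, and all isomorphisms in the axioms are induced by elements of $G$); $\mathbb A$ is identified with a fixed apartment of $\mathcal I$, and the stabilizer of $\mathbb A$ in $G$ induces on $\mathbb A$ the group $W^v\ltimes Y$. $\mathcal I$ is a building if and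 only if $W^v$ is finite. Sector-germs of $\mathcal I$ are sector-germs of its apartments (a sector-germ contained in an apartment $B$ is a sector-germ of $B$, of the same sign). **Translations and the sets $U_{\mathfrak s}$.** Let $\mathfrak s$ be a sector-germ of sign $\mathrm{sgn}(\mathfrak s)\in\{+,-\}$, $x\in\mathcal I$, $u\in\overline{C^v_f}$. Choose an apartment $A_1$ containing $x$ and $\mathfrak s$ and an isomorphism $\psi:\mathbb A\to A_1$ with $\psi(\mathrm{sgn}(\mathfrak s)\infty)=\mathfrak s$; then $x+_{\mathfrak s}u:=\psi(\psi^{-1}(x)+\mathrm{sgn}(\mathfrak s)u)$ is independent of choices. $U_{\mathfrak s}(x,x')=\{(u,u')\in\overline{C^v_f}^2\mid x+_{\mathfrak s}u=x'+_{\mathfrak s}u'\}$, which is nonempty for all $x,x'\in\mathcal I$. $\Theta_+$ (resp. $\Theta_-$) is the set of pairs $\theta=(|\cdot|,\mathfrak s)$ with $|\cdot|$ a norm on $\mathbb A$ and $\mathfrak s$ a positive (resp. negative) sector-germ of $\mathcal I$. *)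

(* Defs.v *)
From mathcomp Require Import all_boot all_order all_algebra.
From mathcomp Require Import complex.
From mathcomp Require Import all_classical all_reals all_analysis.
Import Order.TTheory GRing.Theory Num.Theory.
Import numFieldNormedType.Exports.

Set Implicit Arguments.
Unset Strict Implicit.
Unset Printing Implicit Defensive.

Local Open Scope classical_set_scope.
Local Open Scope ring_scope.

(* A basis is chosen, so that Y = Z^n is written in columns, the dual X in
   rows, and the duality is the matrix product. *)
Record km_datum (I : finType) (n : nat) := KMDatum {
  cartan : I -> I -> int;
  sroot : I -> 'rV[int]_n;
  scoroot : I -> 'cV[int]_n;
  cartan_diag : forall i, cartan i i = 2;
  cartan_offdiag : forall i j, i != j -> cartan i j <= 0;
  cartan_eq0 : forall i j, cartan i j = 0 <-> cartan j i = 0;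
  sroot_free : forall m : I -> int,
    \sum_i m i *: sroot i = 0 -> forall i, m i = 0;
  scoroot_free : forall m : I -> int,
    \sum_i m i *: scoroot i = 0 -> forall i, m i = 0;
  sroot_scoroot : forall i j, (sroot j *m scoroot i) 0 0 = cartan i j
}.

Section Vectorial.
Context (R : realType) (I : finType) (n : nat) (D : km_datum I n).

(* The model space Y (x) R is A; linear forms on A are row vectors. *)
Local Notation A := ('cV[R]_n).
Local Notation dualA := ('rV[R]_n).

Definition ev (K : pzRingType) (a : 'rV[K]_n) (v : 'cV[K]_n) : K :=
  (a *m v) 0 0.

Definition sroot_in (K : pzRingType) (i : I) : 'rV[K]_n :=
  map_mx intr (sroot D i).
Definition scoroot_in (K : pzRingType) (i : I) : 'cV[K]_n :=
  map_mx intr (scoroot D i).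

Definition alpha (i : I) : dualA := sroot_in R i.
Definition alphav (i : I) : A := scoroot_in R i.

(* refl i *m v = v - alpha_i(v) alpha_i^vee *)
Definition refl (i : I) : 'M[R]_n := 1%:M - alphav i *m alpha i.

(* The refl i being involutions, the monoid they generate is a group. *)
Inductive weyl : 'M[R]_n -> Prop :=
| weyl1 : weyl 1%:M
| weylM i w : weyl w -> weyl (refl i *m w).

Definition real_root_pair (a : dualA) (av : A) : Prop :=
  exists w i, [/\ weyl w, a = alpha i *m invmx w & av = w *m alphav i].

Definition Phi : set dualA := [set a | exists av, real_root_pair a av].

(* The Kac-Moody algebra over K = R[i] is the quotient of lie_term by km_eq:
   the Lie algebra generated by Y (x) K and the Chevalley generators e_i, f_i,
   subject to the Serre presentation.  (Dividing further by the largest ideal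
   meeting Y (x) K trivially would not change the set of roots.) *)
Local Notation K := (R[i]).
Local Notation cartanC := ('cV[K]_n).

Inductive lie_term : Type :=
| LE of I
| LF of I
| LH of cartanC
| LZero
| LAdd of lie_term & lie_term
| LScale of K & lie_term
| LBr of lie_term & lie_term.

Inductive km_eq : lie_term -> lie_term -> Prop :=
| km_refl t : km_eq t t
| km_sym t u : km_eq t u -> km_eq u t
| km_trans t u v : km_eq t u -> km_eq u v -> km_eq t v
| km_congrD t t' u u' :
    km_eq t t' -> km_eq u u' -> km_eq (LAdd t u) (LAdd t' u')
| km_congrZ a t t' : km_eq t t' -> km_eq (LScale a t) (LScale a t')
| km_congrB t t' u u' :
    km_eq t t' -> km_eq u u' -> km_eq (LBr t u) (LBr t' u')
| km_addA t u v : km_eq (LAdd t (LAdd u v)) (LAdd (LAdd t u) v)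
| km_addC t u : km_eq (LAdd t u) (LAdd u t)
| km_add0 t : km_eq (LAdd LZero t) t
| km_addN t : km_eq (LAdd (LScale (-1) t) t) LZero
| km_scaleA a b t : km_eq (LScale a (LScale b t)) (LScale (a * b) t)
| km_scale1 t : km_eq (LScale 1 t) t
| km_scaleDr a t u :
    km_eq (LScale a (LAdd t u)) (LAdd (LScale a t) (LScale a u))
| km_scaleDl a b t :
    km_eq (LScale (a + b) t) (LAdd (LScale a t) (LScale b t))
| km_brDl t u v : km_eq (LBr (LAdd t u) v) (LAdd (LBr t v) (LBr u v))
| km_brDr t u v : km_eq (LBr t (LAdd u v)) (LAdd (LBr t u) (LBr t v))
| km_brZl a t u : km_eq (LBr (LScale a t) u) (LScale a (LBr t u))
| km_brZr a t u : km_eq (LBr t (LScale a u)) (LScale a (LBr t u))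
| km_br_alt t : km_eq (LBr t t) LZero
| km_jacobi t u v :
    km_eq (LAdd (LBr t (LBr u v)) (LAdd (LBr u (LBr v t)) (LBr v (LBr t u))))
          LZero
| km_H_lin a (h h' : cartanC) :
    km_eq (LH (a *: h + h')) (LAdd (LScale a (LH h)) (LH h'))
| km_HH h h' : km_eq (LBr (LH h) (LH h')) LZero
| km_HE h i : km_eq (LBr (LH h) (LE i)) (LScale (ev (sroot_in K i) h) (LE i))
| km_HF h i :
    km_eq (LBr (LH h) (LF i)) (LScale (- ev (sroot_in K i) h) (LF i))
| km_EF_diag i : km_eq (LBr (LE i) (LF i)) (LH (scoroot_in K i))
| km_EF_off i j : i != j -> km_eq (LBr (LE i) (LF j)) LZero
| km_serreE i j : i != j ->
    km_eq (iter `|1 - cartan D i j|%N (LBr (LE i)) (LE j)) LZero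
| km_serreF i j : i != j ->
    km_eq (iter `|1 - cartan D i j|%N (LBr (LF i)) (LF j)) LZero.

(* All roots, real and imaginary: the nonzero a = sum_i m_i alpha_i whose root
   space in the Kac-Moody algebra is nonzero. *)
Definition Delta : set dualA := [set a | a != 0 /\
  exists m : I -> int,
    a = \sum_i (m i)%:~R *: alpha i /\
    exists t, ~ km_eq t LZero /\
      forall h : cartanC,
        km_eq (LBr (LH h) t)
              (LScale (\sum_i (m i)%:~R * ev (sroot_in K i) h) t)].

(* None stands for k = +oo *)
Definition halfsp (a : dualA) (k : option int) : set A :=
  if k is Some k then [set x | 0 <= ev a x + k%:~R] else setT.
Definition ohalfsp (a : dualA) (k : option int) : set A :=
  if k is Some k then [set x | 0 < ev a x + k%:~R] else setT.
Definition wall (a : dualA) (k : int) : set A :=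
  [set x | ev a x + k%:~R = 0].

(* w |x T for a subset T of translations; affW setT is W^v |x A. *)
Definition affW (T : set A) : set (A -> A) :=
  [set h | exists w t, [/\ weyl w, T t & h = fun v => w *m v + t]].

Definition corootlat : set A :=
  [set q | exists m : I -> int, q = \sum_i (m i)%:~R *: alphav i].
Definition Ylat : set A := [set y | exists z : 'cV[int]_n, y = map_mx intr z].

Definition Wa : set (A -> A) := affW corootlat.

Definition marked_walls : set (set A * A) :=
  [set p | exists a k, real_root_pair a p.2 /\ p.1 = wall a k].

(* An affine bijection acts on marked walls through its linear part B on the
   coroots. *)
Definition AutA : set (A -> A) :=
  [set h | exists B t, [/\ B \in unitmx, h = (fun v => B *m v + t) &
     (fun p : set A * A => (h @` p.1, B *m p.2)) @` marked_walls
       = marked_walls]].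

Definition vWeylAut : set (A -> A) := affW setT `&` AutA.

Definition translate (x : A) (Z : set A) : set A := (fun v => x + v) @` Z.
Definition msum (Z Z' : set A) : set A :=
  [set v | exists z z', [/\ Z z, Z' z' & v = z + z']].

Definition Fv (J : {set I}) : set A :=
  [set v | forall i, if i \in J then ev (alpha i) v = 0
                     else 0 < ev (alpha i) v].
Definition Cvf : set A := [set v | forall i, 0 < ev (alpha i) v].

(* Signs are booleans: true is +, false is -. *)
Definition sgn (eps : bool) : R := if eps then 1 else -1.

Definition vface (eps : bool) (F : set A) : Prop :=
  exists w J, weyl w /\ F = (fun v => sgn eps *: (w *m v)) @` Fv J.
Definition is_vface (F : set A) : Prop := exists eps, vface eps F.
Definition vchamber (eps : bool) (F : set A) : Prop :=
  exists w, weyl w /\ F = (fun v => sgn eps *: (w *m v)) @` Cvf.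

Definition tits : set A :=
  [set v | exists w u, [/\ weyl w, closure Cvf u & v = w *m u]].
Definition pm_int_tits : set A := [set v | interior tits v \/ interior tits (- v)].
Definition spherical (F : set A) : Prop := F `&` pm_int_tits !=set0.
Definition leT (x y : A) : Prop := tits (y - x).

Definition segment (x y : A) : set A :=
  [set v | exists t : R, 0 <= t <= 1 /\ v = x + t *: (y - x)].
Definition ray (x y : A) : set A :=
  [set v | exists t : R, 0 <= t /\ v = x + t *: (y - x)].

(* Filters.  All those below are upward closed, so that Z contains the filter F
   (Z contains an element of F, F lies in Z) reads F Z. *)

Definition affine_sub (S : set A) : Prop :=
  forall x y (t : R), S x -> S y -> S (x + t *: (y - x)).
Definition support (F : set_system A) : set A :=
  \bigcap_(S in [set S | affine_sub S /\ F S]) S.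
Definition direction (S : set A) : set A :=
  [set v | exists x y, [/\ S x, S y & v = y - x]].

Definition enclosure (F : set_system A) : set_system A :=
  [set E | exists k : dualA -> option int,
     F (\bigcap_(a in Delta) halfsp a (k a)) /\
     \bigcap_(a in Delta) halfsp a (k a) `<=` E].

Definition Cup (T : Type) (F F' : set_system T) : set_system T :=
  [set Z | exists E E', [/\ F E, F' E' & Z = E `|` E']].

Definition sector_face_germ (x : A) (V : set A) : set_system A :=
  [set E | exists2 u, closure V u & translate (x + u) V `<=` E].

Definition pm_infty (eps : bool) : set_system A :=
  sector_face_germ 0 ((fun v => sgn eps *: v) @` Cvf).

Definition face (x : A) (V : set A) : set_system A :=
  [set E | exists k k' : dualA -> option int,
     let P := \bigcap_(a in Delta) (halfsp a (k a) `&` ohalfsp a (k' a)) in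
     P `<=` E /\
     exists2 Omega, nbhs x Omega & Omega `&` translate x V `<=` P].
Definition is_face (F : set_system A) : Prop :=
  exists x V, is_vface V /\ F = face x V.
Definition is_chamber (F : set_system A) : Prop :=
  is_face F /\ support F = setT.
Definition is_panel (F : set_system A) : Prop :=
  is_face F /\ exists a k, Phi a /\ support F = wall a k.

Definition filter_add (F : set_system A) (Z : set A) : set_system A :=
  [set E | exists2 E', F E' & msum E' Z `<=` E].

Definition chimney (F : set_system A) (V : set A) : set_system A :=
  enclosure (filter_add F V).
Definition chimney_germ (F : set_system A) (V : set A) : set_system A :=
  [set E | exists2 u, closure V u & chimney (filter_add F [set u]) V E].
Definition solid (F : set_system A) (V : set A) : Prop :=
  finite_set [set w | weyl w /\
    forall v, direction (support (chimney F V)) v -> w *m v = v].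

Definition solid_chimney (F : set_system A) : Prop :=
  exists F0 V, [/\ is_face F0, is_vface V, solid F0 V & F = chimney F0 V].
Definition solid_chimney_germ (F : set_system A) : Prop :=
  exists F0 V, [/\ is_face F0, is_vface V, solid F0 V & F = chimney_germ F0 V].
Definition splayed_chimney_germ (F : set_system A) : Prop :=
  exists F0 V,
    [/\ is_face F0, is_vface V, spherical V & F = chimney_germ F0 V].

(* The germ at x of an interval with origin x, closed or open at x. *)
Definition preordered_germ (F : set_system A) : Prop :=
  exists x y, [/\ x <> y, leT x y \/ leT y x &
    F = within (segment x y) (nbhs x) \/
    F = within (segment x y `\ x) (nbhs x)].
Definition generic_ray (Z : set A) : Prop :=
  exists x y, [/\ x <> y, pm_int_tits (y - x) & Z = ray x y].

Definition MA2_filter (F : set_system A) : Prop :=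
  [\/ exists x, F = globally [set x], preordered_germ F,
      exists2 Z, generic_ray Z & F = globally Z | solid_chimney F].
Definition MA3_filter (F : set_system A) : Prop :=
  is_face F \/ solid_chimney_germ F.

Definition is_norm (N : A -> R) : Prop :=
  [/\ forall v, 0 <= N v, forall v, N v = 0 -> v = 0,
      forall (a : R) v, N (a *: v) = `|a| * N v &
      forall u v, N (u + v) <= N u + N v].

Section Apartments.
Context (T : Type).

Record apartment_system := ApartmentSystem {
  apt : set (set T);
  isomw : set T -> set (A -> T);
  apt_cover : forall x, exists2 B, apt B & B x;
  isomw_bij : forall B f, apt B -> isomw B f -> set_bij setT B f;
  isomw_orbit : forall B, apt B ->
    exists f0, isomw B = [set f | exists2 h, Wa h & f = fun v => f0 (h v)]
}.

(* "Isomorphism" without further qualification (apt_iso, model_iso) means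
   vectorially Weyl isomorphism. *)
Variable S : apartment_system.

(* Only the restriction of phi to B is relevant. *)
Definition gen_iso (H : set (A -> A)) (B B' : set T) (phi : T -> T) : Prop :=
  forall f f', isomw S B f -> isomw S B' f' ->
    exists2 h, H h & forall v, phi (f v) = f' (h v).
Definition weyl_iso := gen_iso Wa.
Definition apt_iso := gen_iso vWeylAut.

Definition model_iso (B : set T) (psi : A -> T) : Prop :=
  forall f, isomw S B f -> exists2 h, vWeylAut h & forall v, psi v = f (h v).

Definition in_some_apt (P : set_system A -> Prop) (F : set_system T) : Prop :=
  exists B f F0, [/\ apt S B, isomw S B f, P F0 & F = fmap f F0].

(* The trace on A, via f, of a filter on T lying in the range of f. *)
Definition pull (f : A -> T) (F : set_system T) : set_system A :=
  [set E | F (f @` E)].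

Definition fixes (phi : T -> T) (f : A -> T) (F : set_system A) : Prop :=
  exists2 E, F E & forall v, E v -> phi (f v) = f v.

Definition MA2_data (B B' : set T) (f : A -> T) (F : set_system A) : Prop :=
  [/\ apt S B, apt S B', isomw S B f, MA2_filter F & fmap f F B'].

Definition MA3_data (Rg F : set_system T) : Prop :=
  in_some_apt splayed_chimney_germ Rg /\ in_some_apt MA3_filter F.

Definition MA4_data (B B' : set T) (f : A -> T) (Rg F : set_system T) : Prop :=
  [/\ MA3_data Rg F, apt S B /\ apt S B', isomw S B f, Rg B /\ F B &
      Rg B' /\ F B'].

Record is_masure : Prop := IsMasure {
  MA2 : forall B B' f F, MA2_data B B' f F ->
    (exists2 E, enclosure F E & f @` E `<=` B `&` B') /\
    (exists phi, weyl_iso B B' phi /\ fixes phi f (enclosure F));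
  MA3 : forall Rg F, MA3_data Rg F -> exists B, [/\ apt S B, Rg B & F B];
  MA4 : forall B B' f Rg F, MA4_data B B' f Rg F ->
    exists phi, weyl_iso B B' phi /\
      fixes phi f (enclosure (Cup (pull f Rg) (pull f F)));
  MAO : forall B B' f f' u v u' v',
    apt S B -> apt S B' -> isomw S B f -> isomw S B' f' ->
    f u = f' u' -> f v = f' v' -> leT u v ->
    f @` segment u v = f' @` segment u' v'
}.

(* The chambers C whose closure contains P: for each element E of C, P lies in
   the closure of E (taken in an apartment of C). *)
Definition chambers_around (P : set_system T) : set (set_system T) :=
  [set C | exists B f C0,
     [/\ apt S B, isomw S B f, is_chamber C0, C = fmap f C0 &
         forall E, C0 E -> P (f @` closure E)]].

Definition thick_finite : Prop :=
  forall P, in_some_apt is_panel P ->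
    finite_set (chambers_around P) /\ (`I_3 #<= chambers_around P)%card.

Definition axiom_iso (B B' : set T) (phi : T -> T) : Prop :=
  weyl_iso B B' phi /\
  ((exists f F, MA2_data B B' f F /\ fixes phi f (enclosure F)) \/
   (exists f Rg F, MA4_data B B' f Rg F /\
      fixes phi f (enclosure (Cup (pull f Rg) (pull f F))))).

Record strongly_transitive (G : groupType) (act : G -> T -> T) : Prop :=
  StronglyTransitive {
  act1 : forall x, act 1%g x = x;
  actM : forall g h x, act (g * h)%g x = act g (act h x);
  act_apt : forall g B, apt S B -> apt S (act g @` B);
  act_iso : forall g B, apt S B -> apt_iso B (act g @` B) (act g);
  act_axioms : forall B B' phi, axiom_iso B B' phi ->
    exists g, forall x, B x -> act g x = phi x
}.

(* f0 identifies A with the apartment A0. *)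
Definition stabilizer_induces (G : groupType) (act : G -> T -> T)
    (A0 : set T) (f0 : A -> T) (H : set (A -> A)) : Prop :=
  [set h | exists g, act g @` A0 = A0 /\ forall v, act g (f0 v) = f0 (h v)]
    = H.

Definition sector_germ (eps : bool) (s : set_system T) : Prop :=
  in_some_apt (fun F => exists x V, vchamber eps V /\ F = sector_face_germ x V)
    s.

(* translated eps s x u y : y = x +_s u *)
Definition translated (eps : bool) (s : set_system T) (x : T) (u : A) (y : T)
    : Prop :=
  exists B psi v,
    [/\ apt S B /\ s B, model_iso B psi, fmap psi (pm_infty eps) = s,
        psi v = x & y = psi (v + sgn eps *: u)].

Definition Uset (eps : bool) (s : set_system T) (x x' : T) : set (A * A) :=
  [set p | [/\ closure Cvf p.1, closure Cvf p.2 &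
     exists y, translated eps s x p.1 y /\ translated eps s x' p.2 y]].

Definition dtheta (N : A -> R) (eps : bool) (s : set_system T) (x x' : T) : R :=
  inf [set N p.1 + N p.2 | p in Uset eps s x x'].

End Apartments.
End Vectorial.

Definition is_distance (R : realType) (T : Type) (d : T -> T -> R) : Prop :=
  [/\ forall x y, 0 <= d x y, forall x y, d x y = 0 <-> x = y,
      forall x y, d x y = d y x &
      forall x y z, d x z <= d x y + d y z].

(* Main.v *)
Require Import Defs.
From HB Require Import structures.
From mathcomp Require Import all_boot all_order all_algebra.
From mathcomp Require Import complex.
From mathcomp Require Import all_classical all_reals all_analysis.
From mathcomp Require Import ring lra zify.
Import Order.TTheory GRing.Theory Num.Theory.
Import numFieldNormedType.Exports.
Set Implicit Arguments.
Unset Strict Implicit.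
Unset Printing Implicit Defensive.
Local Open Scope classical_set_scope.
Local Open Scope ring_scope.

(* Write x +_s u for the translate of x in any chart of an apartment containing x
   and s. By (MA4) two charts sending the same germ at infinity to s, and taking
   the same value at a point, agree on the closed cone issued from that point, up
   to an automorphism of A fixing the germ at infinity; the latter is a translation
   because the Weyl group is simply transitive on chambers. Hence
   (x +_s u) +_s v = x +_s (u + v), which gives the triangle inequality.

   If d(x, x') = 0, choose charts f, f' with f v = x and f' v' = x'. The difference
   u' - u is the same for all (u, u') in U_s(x, x') and has norm at most
   |u| + |u'|, so it is 0. Taking u to 0 shows that f (v + t c) = f' (v' + t c) for
   all t > 0 and c in the open chamber, and (MA2) for the germ of the open segment
   ]v, v + c[ puts x in the apartment of f', whence x = x'.

   Two facts on Kac-Moody data are needed: +-alpha_i belongs to Delta, so that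
   sector-germs are germs of splayed chimneys, and simple transitivity. Both follow
   from the action on a highest weight module: e_i and f_i act non-trivially, and
   the weights are stable under the Weyl group and lie below the highest one. *)

(** * Commutators and linear operators *)

Section Commutator.
Variable L : pzRingType.
Implicit Types x y z : L.

Definition br x y := x * y - y * x.

Lemma brDl x y z : br (x + y) z = br x z + br y z.
Proof. by rewrite /br mulrDl mulrDr opprD addrACA. Qed.

Lemma brC x y : br x y = - br y x.
Proof. by rewrite /br opprB. Qed.

Lemma brDr x y z : br x (y + z) = br x y + br x z.
Proof. by rewrite brC brDl opprD -!brC. Qed.

Lemma brNr x y : br x (- y) = - br x y.
Proof. by rewrite /br mulrN mulNr opprB opprK addrC. Qed.

Lemma brNl x y : br (- x) y = - br x y.
Proof. by rewrite brC brNr opprK brC. Qed.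

Lemma br0r x : br x 0 = 0.
Proof. by rewrite /br mulr0 mul0r subrr. Qed.

Lemma brxx x : br x x = 0.
Proof. exact: subrr. Qed.

Lemma brMzr x y (k : int) : br x (y *~ k) = br x y *~ k.
Proof. by rewrite /br mulrzAr mulrzAl mulrzBl. Qed.

Lemma brMzl x y (k : int) : br (x *~ k) y = br x y *~ k.
Proof. by rewrite brC brMzr -mulNrz -brC. Qed.

Lemma br_jacobi x y z : br x (br y z) = br (br x y) z + br y (br x z).
Proof.
have abel (a b c d e g : L) :
    a - b - (c - d) = (a - e - (g - d)) + (e - c - (b - g)).
  rewrite !opprB [RHS]addrACA !subrKA.
  by rewrite addrACA (addrC (- b)) addrACA.
by rewrite /br !mulrBr !mulrBl !mulrA; exact: abel.
Qed.

Lemma br_jacobi0 x y z : br x (br y z) + (br y (br z x) + br z (br x y)) = 0.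
Proof.
by rewrite br_jacobi (brC z x) (brC z) brNr addrA addrK addrN.
Qed.

End Commutator.


(** * The sl2 computation behind the Serre relations *)

Section SerreRelation.
Variables (L : pzRingType) (e f h x0 : L) (a : int).
Hypotheses (fe : br f e = - h) (he : br h e = e *~ 2).
Hypotheses (hx : br h x0 = x0 *~ a) (fx : br f x0 = 0).

Lemma br_weight_iter m :
  br h (iter m (br e) x0) = iter m (br e) x0 *~ (a + 2 * m%:Z).
Proof.
elim: m => [|m IH] /=; first by rewrite mulr0 addr0.
rewrite br_jacobi he IH brMzl brMzr -mulrzDr; congr (_ *~ _); lia.
Qed.

(** Moving [br f] through the m+1 brackets with [e] leaves one term for each, with coefficient the
    weight a + 2j of the vector met there; the sum over j = 0, ..., m is (m+1)(a+m). *)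
Lemma br_lower_iter m :
  br f (iter m.+1 (br e) x0) = - (iter m (br e) x0 *~ (m.+1%:Z * (a + m%:Z))).
Proof.
elim: m => [|m IH] /=.
  by rewrite br_jacobi fe fx br0r addr0 brNl hx mul1r addr0.
rewrite br_jacobi fe [X in _ + br e X]IH brNl brNr brMzr -/(iter m.+1 (br e) x0).
rewrite br_weight_iter -opprD -mulrzDr; congr (- (_ *~ _)); lia.
Qed.

(** The coefficient in [br_lower_iter] vanishes at m = -a, hence for 1 - a brackets, the exponent of
    the Serre relations. *)
Lemma br_serre : a <= 0 -> br f (iter `|1 - a|%N (br e) x0) = 0.
Proof.
move=> a0; have -> : `|1 - a|%N = (`|a|).+1 by lia.
rewrite br_lower_iter; have -> : a + `|a|%:Z = 0 by lia.
by rewrite mulr0 mulr0z oppr0.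
Qed.

End SerreRelation.

Lemma br_iter_comm (L : pzRingType) (e f x0 : L) m : br f e = 0 ->
  br f (iter m (br e) x0) = iter m (br e) (br f x0).
Proof.
move=> fe; elim: m => //= m <-.
by rewrite br_jacobi fe /br mul0r mulr0 subrr add0r.
Qed.

(** A second bracket with [e] already gives 0; only when there is a single bracket must b itself
    vanish. *)
Lemma iter_br_eq0 (L : pzRingType) (e x : L) (b : int) m :
  br e x = e *~ b -> (m = 0 -> b = 0) -> iter m.+1 (br e) x = 0.
Proof.
move=> ex; case: m => [/(_ erefl) b0|m _] /=; first by rewrite ex b0 mulr0z.
elim: m => [|m IH] /=; first by rewrite ex brMzr brxx mul0rz.
by rewrite IH br0r.
Qed.

Section LinearOperators.
Variables (K : comPzRingType) (M : lmodType K).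

(** Bundled endomorphisms form a ring whose commutator is [br], so the identities above apply to
    operators on a module of infinite rank. *)
Record linop := Linop { linop_fun :> M -> M; _ : linear linop_fun }.

HB.instance Definition _ := gen_eqMixin linop.
HB.instance Definition _ := gen_choiceMixin linop.

Lemma linop_linear (x : linop) : linear x.
Proof. by case: x. Qed.

HB.instance Definition _ (x : linop) :=
  GRing.isLinear.Build K M M *:%R x (linop_linear x).

Lemma linopP (x y : linop) : (forall v, x v = y v) -> x = y.
Proof.
case: x => x hx; case: y => y hy /= xy.
have {}xy : x = y by apply/funext.
by subst y; congr Linop; exact: Prop_irrelevance.
Qed.

Definition linop_zero : linop.
Proof. by exists (fun=> 0) => a u v; rewrite scaler0 addr0. Defined.
Definition linop_opp (x : linop) : linop.
Proof. by exists (fun v => - x v) => a u v; rewrite linearP opprD scalerN. Defined.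
Definition linop_add (x y : linop) : linop.
Proof.
by exists (fun v => x v + y v) => a u v; rewrite !linearP scalerDr addrACA.
Defined.
Definition linop_one : linop.
Proof. by exists id. Defined.
Definition linop_mul (x y : linop) : linop.
Proof. by exists (fun v => x (y v)) => a u v; rewrite !linearP. Defined.
Definition linop_scale (c : K) (x : linop) : linop.
Proof.
exists (fun v => c *: x v) => a u v.
by rewrite linearP scalerDr !scalerA mulrC.
Defined.

Let addA : associative linop_add.
Proof. by move=> x y z; apply: linopP => v /=; rewrite addrA. Qed.
Let addC : commutative linop_add.
Proof. by move=> x y; apply: linopP => v /=; rewrite addrC. Qed.
Let add0 : left_id linop_zero linop_add.
Proof. by move=> x; apply: linopP => v /=; rewrite add0r. Qed.
Let addN : left_inverse linop_zero linop_opp linop_add.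
Proof. by move=> x; apply: linopP => v /=; rewrite addNr. Qed.

HB.instance Definition _ := GRing.isZmodule.Build linop addA addC add0 addN.

Let mulA : associative linop_mul.
Proof. by move=> x y z; apply: linopP. Qed.
Let mul1 : left_id linop_one linop_mul.
Proof. by move=> x; apply: linopP. Qed.
Let mulo1 : right_id linop_one linop_mul.
Proof. by move=> x; apply: linopP. Qed.
Let mulDl : left_distributive linop_mul linop_add.
Proof. by move=> x y z; apply: linopP. Qed.
Let mulDr : right_distributive linop_mul linop_add.
Proof. by move=> x y z; apply: linopP => v /=; rewrite linearD. Qed.

HB.instance Definition _ :=
  GRing.Zmodule_isPzRing.Build linop mulA mul1 mulo1 mulDl mulDr.

Lemma linopDE (x y : linop) v : (x + y) v = x v + y v. Proof. by []. Qed.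
Lemma linopNE (x : linop) v : (- x) v = - x v. Proof. by []. Qed.
Lemma linop_brE (x y : linop) v : br x y v = x (y v) - y (x v).
Proof. by []. Qed.
Lemma linopMnE (x : linop) n v : (x *+ n) v = x v *+ n.
Proof. by elim: n => // n IH; rewrite !mulrS linopDE IH. Qed.
Lemma linopMzE (x : linop) (k : int) v : (x *~ k) v = x v *~ k.
Proof. by case: k => n; rewrite ?NegzE ?mulrNz ?linopNE ?pmulrn linopMnE. Qed.

Lemma linop_brZl a (x y : linop) :
  br (linop_scale a x) y = linop_scale a (br x y).
Proof. by apply: linopP => v; rewrite linop_brE /= linearZ /= -scalerBr. Qed.
Lemma linop_brZr a (x y : linop) :
  br x (linop_scale a y) = linop_scale a (br x y).
Proof. by apply: linopP => v; rewrite linop_brE /= linearZ /= -scalerBr. Qed.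

End LinearOperators.

(** * A highest weight module of the Kac-Moody algebra *)

Section HighestWeight.
Context (K : numFieldType) (I : finType) (n : nat) (D : km_datum I n).
Variable lam : 'rV[K]_n.

Local Notation al := (sroot_in D K).
Local Notation alv := (scoroot_in D K).
Local Notation M := (seq I -> K^o).
Local Notation op := (linop M).
Implicit Types (phi psi : M) (w : seq I) (i j k : I) (h : 'cV[K]_n).

Lemma evDl (a b : 'rV[K]_n) v : ev (a + b) v = ev a v + ev b v.
Proof. by rewrite /ev mulmxDl mxE. Qed.
Lemma evDr (a : 'rV[K]_n) v v' : ev a (v + v') = ev a v + ev a v'.
Proof. by rewrite /ev mulmxDr mxE. Qed.
Lemma evZl c (a : 'rV[K]_n) v : ev (c *: a) v = c * ev a v.
Proof. by rewrite /ev -scalemxAl mxE. Qed.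
Lemma evZr c (a : 'rV[K]_n) v : ev a (c *: v) = c * ev a v.
Proof. by rewrite /ev -scalemxAr mxE. Qed.
Lemma evNl (a : 'rV[K]_n) v : ev (- a) v = - ev a v.
Proof. by rewrite -scaleN1r evZl mulN1r. Qed.
Lemma evNr (a : 'rV[K]_n) v : ev a (- v) = - ev a v.
Proof. by rewrite -scaleN1r evZr mulN1r. Qed.
Lemma ev_suml (J : finType) (F : J -> 'rV[K]_n) v :
  ev (\sum_j F j) v = \sum_j ev (F j) v.
Proof. by rewrite /ev mulmx_suml summxE. Qed.
Lemma ev_root_coroot i j : ev (al j) (alv i) = (cartan D i j)%:~R.
Proof.
by rewrite /ev /sroot_in /scoroot_in -map_mxM mxE sroot_scoroot.
Qed.

(* [M] is the module coinduced from the highest weight [lam]: a vector x is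
   encoded by the function sending the word [:: i1; ...; im] to the coefficient
   of the highest weight vector in e_im ... e_i1 x. It depends only on the
   component of x of weight [weight [:: i1; ...; im]]. *)
Definition weight w : 'rV[K]_n := lam - \sum_(j <- w) al j.

(* The recursion is forced by e_j f_k x = f_k e_j x + [j = k] h_k x. *)
Definition creation_fun k :=
  fix F (phi : M) (w : seq I) {struct w} : K^o :=
  if w is j :: w' then
    F (fun u => phi (j :: u)) w' +
    (if j == k then ev (weight w') (alv k) * phi w' else 0)
  else 0.

Definition opE k : op.
Proof. by exists (fun phi w => phi (k :: w)). Defined.

Definition opH h : op.
Proof.
exists (fun phi w => ev (weight w) h * phi w) => a u v; apply/funext => w.
by rewrite mulrDr; congr (_ + _); exact: mulrCA.
Defined.

Definition opF k : op.
Proof.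
exists (creation_fun k) => a u v; apply/funext => w.
elim: w u v => [|j w IH] u v /=.
  by change (0 = a * 0 + 0 :> K); rewrite mulr0 addr0.
rewrite [X in X + _ = _](IH (fun x => u (j :: x)) (fun x => v (j :: x))).
change (a * creation_fun k (fun x => u (j :: x)) w +
   creation_fun k (fun x => v (j :: x)) w +
   (if j == k then ev (weight w) (alv k) * (a * u w + v w) else 0) =
  a * (creation_fun k (fun x => u (j :: x)) w +
    (if j == k then ev (weight w) (alv k) * u w else 0)) +
  (creation_fun k (fun x => v (j :: x)) w +
    (if j == k then ev (weight w) (alv k) * v w else 0)) :> K).
by case: eqP => _; ring.
Defined.

Lemma opF_nil k phi : opF k phi [::] = 0. Proof. by []. Qed.

Lemma br_EF k j : br (opE j) (opF k) = if j == k then opH (alv k) else 0.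
Proof.
apply: linopP => phi; apply/funext => w; rewrite linop_brE.
change (creation_fun k (fun u => phi (j :: u)) w +
    (if j == k then ev (weight w) (alv k) * phi w else 0) -
    creation_fun k (fun u => phi (j :: u)) w =
   (if j == k then opH (alv k) else 0) phi w).
by rewrite addrC addKr; case: eqP.
Qed.

Lemma weight_cons j w : weight (j :: w) = weight w - al j.
Proof. by rewrite /weight big_cons opprD addrCA addrC. Qed.

Lemma HE_apply h i phi :
  opH h (opE i phi) = opE i (opH h phi) + ev (al i) h *: opE i phi.
Proof.
apply/funext => w.
change (ev (weight w) h * phi (i :: w) = ev (weight (i :: w)) h * phi (i :: w)
  + ev (al i) h * phi (i :: w) :> K).
by rewrite weight_cons evDl evNl; ring.
Qed.

Lemma HF_apply h k phi :
  opH h (opF k phi) = opF k (opH h phi) - ev (al k) h *: opF k phi.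
Proof.
apply/funext => w; elim: w phi => [|j w IH] phi.
  change (ev (weight [::]) h * 0 = 0 - ev (al k) h * 0 :> K); ring.
have EF psi : opF k psi (j :: w) = opF k (opE j psi) w +
    (if j == k then ev (weight w) (alv k) * psi w else 0) :> K by [].
have := IH (opE j phi).
change (ev (weight w) h * opF k (opE j phi) w =
  opF k (opH h (opE j phi)) w - ev (al k) h * opF k (opE j phi) w :> K ->
  ev (weight (j :: w)) h * opF k phi (j :: w) =
  opF k (opH h phi) (j :: w) - ev (al k) h * opF k phi (j :: w) :> K).
rewrite HE_apply linearD linearZ !EF.
change ((opF k (opE j (opH h phi)) + ev (al j) h *: opF k (opE j phi)) w) with
  (opF k (opE j (opH h phi)) w + ev (al j) h * opF k (opE j phi) w : K).
change (opH h phi w) with (ev (weight w) h * phi w : K).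
rewrite weight_cons evDl evNl.
(* The inductive step for j = k and for j <> k, as scalar identities: y and x are the values at w of
   [opF k (opE j phi)] and [opF k (opE j (opH h phi))], a and b the values at [h] of [weight w] and
   of the j-th root. *)
have key_eq (a b c x y p : K) : a * y = x + b * y - b * y ->
    (a - b) * (y + c * p) = x + c * (a * p) - b * (y + c * p).
  by rewrite addrK => <-; ring.
have key_neq (a b c x y : K) : a * y = x + b * y - c * y ->
    (a - b) * (y + 0) = x + 0 - c * (y + 0).
  by rewrite mulrBl !addr0 => ->; ring.
by case: eqP => [->|_]; [exact: key_eq|exact: key_neq].
Qed.

Lemma opH_lin a h h' : opH (a *: h + h') = linop_scale a (opH h) + opH h'.
Proof.
apply: linopP => phi; apply/funext => w.
change (ev (weight w) (a *: h + h') * phi w =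
  a * (ev (weight w) h * phi w) + ev (weight w) h' * phi w :> K).
by rewrite evDr evZr; ring.
Qed.

Lemma HH_comm h h' : br (opH h) (opH h') = 0.
Proof.
apply: linopP => phi; apply/funext => w.
change (ev (weight w) h * (ev (weight w) h' * phi w)
   - ev (weight w) h' * (ev (weight w) h * phi w) = 0 :> K); ring.
Qed.

Lemma br_HE i j : br (opH (alv i)) (opE j) = opE j *~ cartan D i j.
Proof.
apply: linopP => phi; rewrite linop_brE HE_apply addrC addKr ev_root_coroot.
by rewrite linopMzE scaler_int.
Qed.

Lemma br_HF i j : br (opH (alv i)) (opF j) = opF j *~ (- cartan D i j).
Proof.
apply: linopP => phi; rewrite linop_brE HF_apply addrC addKr ev_root_coroot.
by rewrite linopMzE mulrNz scaler_int.
Qed.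

Definition vac : M := fun w => if w is [::] then 1 else 0.

Lemma opE_vac k : opE k vac = 0. Proof. by []. Qed.
Lemma opH_vac h : opH h vac = ev lam h *: vac.
Proof.
apply/funext => -[|j w].
  change (ev (weight [::]) h * 1 = ev lam h * 1 :> K).
  by rewrite /weight big_nil subr0.
change (ev (weight (j :: w)) h * 0 = ev lam h * 0 :> K); ring.
Qed.

(** The submodule generated by the highest weight vector. Finite support, local nilpotency and the
    Serre relations for the [opE i] are obtained on it, not on all of [M]. *)
Inductive hwmod : M -> Prop :=
| hwmod_vac : hwmod vac
| hwmodF k phi : hwmod phi -> hwmod (opF k phi)
| hwmod_lin (a : K) phi psi : hwmod phi -> hwmod psi -> hwmod (a *: phi + psi).

Lemma hwmod0 : hwmod 0.
Proof.
have := hwmod_lin (-1) hwmod_vac hwmod_vac; by rewrite scaleN1r addNr.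
Qed.
Lemma hwmodZ (a : K) phi : hwmod phi -> hwmod (a *: phi).
Proof. by move=> h; have := hwmod_lin a h hwmod0; rewrite addr0. Qed.
Lemma hwmodD phi psi : hwmod phi -> hwmod psi -> hwmod (phi + psi).
Proof. by move=> h h'; have := hwmod_lin 1 h h'; rewrite scale1r. Qed.
Lemma hwmodB phi psi : hwmod phi -> hwmod psi -> hwmod (phi - psi).
Proof. by move=> h h'; have := hwmod_lin (-1) h' h; rewrite scaleN1r addrC. Qed.

Lemma hwmodH h phi : hwmod phi -> hwmod (opH h phi).
Proof.
elim=> [|k {}phi hp IH|a {}phi psi hp IH hq IH'].
- by rewrite opH_vac; exact/hwmodZ/hwmod_vac.
- by rewrite HF_apply; apply: hwmodB; [exact: hwmodF|exact/hwmodZ/hwmodF].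
- by rewrite linearP; exact: hwmod_lin.
Qed.

Lemma hwmodE k phi : hwmod phi -> hwmod (opE k phi).
Proof.
elim=> [|j {}phi hp IH|a {}phi psi hp IH hq IH'].
- by rewrite opE_vac; exact: hwmod0.
- have -> : opE k (opF j phi) = opF j (opE k phi) + br (opE k) (opF j) phi.
    by rewrite linop_brE addrC subrK.
  apply: hwmodD; first exact: hwmodF.
  by rewrite br_EF; case: eqP => _; [exact: hwmodH|exact: hwmod0].
- by rewrite linearP; exact: hwmod_lin.
Qed.

Lemma cogen_eq0 phi : (forall k, opE k phi = 0) -> phi [::] = 0 -> phi = 0.
Proof.
move=> he h0; apply/funext => -[//|k w].
by have := congr1 (fun psi : M => psi w) (he k).
Qed.

(** An operator commuting with every [opE k] is determined by its values at the empty word, because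
    [X phi] at k :: w equals [X (opE k phi)] at w. *)
Lemma comm_opE_eq0 (X : op) : (forall k, br (opE k) X = 0) ->
  (forall phi, X phi [::] = 0) -> X = 0.
Proof.
move=> he h0; apply: linopP => phi; apply/funext => w.
elim: w phi => [|k w IH] phi; first exact: h0.
have := congr1 (fun Y : op => Y phi w) (he k); rewrite linop_brE.
change (X phi (k :: w) - X (opE k phi) w = 0 -> X phi (k :: w) = 0).
by rewrite IH subr0.
Qed.

Lemma comm_opF_eq0 (X : op) : (forall k, br (opF k) X = 0) -> X vac = 0 ->
  forall phi, hwmod phi -> X phi = 0.
Proof.
move=> hf h0 phi; elim=> [//|k {}phi hp IH|a {}phi psi hp IH hq IH'].
- have := congr1 (fun Y : op => Y phi) (hf k); rewrite linop_brE IH linear0.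
  by move/eqP; rewrite subr_eq0 => /eqP <-.
- by rewrite linearP /= IH IH' scaler0 addr0.
Qed.

Lemma br_FE k j : br (opF k) (opE j) = if j == k then - opH (alv k) else 0.
Proof. by rewrite brC br_EF; case: eqP; rewrite ?oppr0. Qed.

Lemma cartan_abs i j : i != j -> `|1 - cartan D i j|%N = (`|cartan D i j|%N).+1.
Proof. by move/(cartan_offdiag D) => h; lia. Qed.

Lemma cartan_abs0 i j : `|cartan D i j|%N = 0%N -> cartan D j i = 0.
Proof. by move=> h; apply/cartan_eq0; lia. Qed.

Definition serreE i j : op := iter `|1 - cartan D i j|%N (br (opE i)) (opE j).
Definition serreF i j : op := iter `|1 - cartan D i j|%N (br (opF i)) (opF j).

(** For k = i this is [br_serre]. Otherwise [opF k] commutes with [opE i], so its bracket falls on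
    [opE j] and gives 0 or, up to sign, the operator of the j-th coroot, whose bracket with [opE i]
    is a multiple of [opE i] and dies at the next bracket. If there is no next bracket, then c_ij =
    0, which forces c_ji = 0. *)
Lemma serreE_comm i j k : i != j -> br (opF k) (serreE i j) = 0.
Proof.
move=> ij; rewrite /serreE; have [<-{k}|ki] := eqVneq i k.
  apply: (br_serre (h := opH (alv i)) (a := cartan D i j)).
  - by rewrite br_FE eqxx.
  - by rewrite br_HE cartan_diag.
  - by rewrite br_HE.
  - by rewrite br_FE eq_sym (negbTE ij).
  - exact: cartan_offdiag.
rewrite br_iter_comm; last by rewrite br_FE (negbTE ki).
rewrite br_FE cartan_abs //; case: eqP => [<-{k ki}|_].
  apply: (iter_br_eq0 (b := cartan D j i)); last exact: cartan_abs0.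
  by rewrite brNr brC opprK br_HE.
by apply: (iter_br_eq0 (b := 0)) => //; rewrite br0r mulr0z.
Qed.

Lemma serreF_comm i j k : i != j -> br (opE k) (serreF i j) = 0.
Proof.
move=> ij; rewrite /serreF; have [<-{k}|ki] := eqVneq i k.
  apply: (br_serre (h := - opH (alv i)) (a := cartan D i j)).
  - by rewrite br_EF eqxx opprK.
  - by rewrite brNl br_HF cartan_diag -mulrNz opprK.
  - by rewrite brNl br_HF -mulrNz opprK.
  - by rewrite br_EF (negbTE ij).
  - exact: cartan_offdiag.
rewrite br_iter_comm; last by rewrite br_EF eq_sym (negbTE ki).
rewrite br_EF cartan_abs //; case: eqP => [_|_].
  apply: (iter_br_eq0 (b := cartan D j i)); last exact: cartan_abs0.
  by rewrite brC br_HF mulrNz opprK.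
by apply: (iter_br_eq0 (b := 0)) => //; rewrite br0r mulr0z.
Qed.

Lemma serreE_hwmod i j phi : i != j -> hwmod phi -> serreE i j phi = 0.
Proof.
move=> ij; apply: comm_opF_eq0; first by move=> k; exact: serreE_comm.
rewrite /serreE; elim: `|_|%N => [|m IH]; first exact: opE_vac.
by rewrite iterS linop_brE IH opE_vac !linear0 addr0.
Qed.

Lemma serreF_eq0 i j : i != j -> serreF i j = 0.
Proof.
move=> ij; apply: comm_opE_eq0; first by move=> k; exact: serreF_comm.
rewrite /serreF => phi; elim: `|_|%N phi => [|m IH] phi; first exact: opF_nil.
rewrite iterS linop_brE.
change (opF i (iter m (br (opF i)) (opF j) phi) [::] -
   iter m (br (opF i)) (opF j) (opF i phi) [::] = 0).
by rewrite IH opF_nil subrr.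
Qed.

End HighestWeight.

(** * The Kac-Moody algebra acts on the highest weight module *)

Section KacMoodyAction.
Context (R : realType) (I : finType) (n : nat) (D : km_datum I n).
Local Notation K := (R[i]).
Variable lam : 'rV[K]_n.
Local Notation M := (seq I -> K^o).

Fixpoint lie_act (t : lie_term R I n) : linop M :=
  match t with
  | LE i => opE K i
  | LF i => opF D lam i
  | LH h => opH D lam h
  | LZero => 0
  | LAdd t u => lie_act t + lie_act u
  | LScale a t => linop_scale a (lie_act t)
  | LBr t u => br (lie_act t) (lie_act u)
  end.

Lemma hwmod_lie_act t (phi : M) : hwmod D lam phi -> hwmod D lam (lie_act t phi).
Proof.
elim: t phi => [i|i|h||t IHt u IHu|a t IHt|t IHt u IHu] phi hp /=.
- exact: hwmodE.
- exact: hwmodF.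
- exact: hwmodH.
- exact: hwmod0.
- by apply: hwmodD; [exact: IHt|exact: IHu].
- by apply: hwmodZ; exact: IHt.
- by apply: hwmodB; [apply/IHt/IHu|apply/IHu/IHt].
Qed.

Lemma lie_act_iter i t (x : linop M) m : lie_act t = x ->
  lie_act (iter m (LBr (LE R n i)) t) = iter m (br (opE K i)) x.
Proof. by move=> <-; elim: m => [|m IH]; [|rewrite [RHS]iterS -IH]; reflexivity. Qed.

Lemma lie_act_iterF i t (x : linop M) m : lie_act t = x ->
  lie_act (iter m (LBr (LF R n i)) t) = iter m (br (opF D lam i)) x.
Proof. by move=> <-; elim: m => [|m IH]; [|rewrite [RHS]iterS -IH]; reflexivity. Qed.

(** This is the means of proving that an element of the algebra is nonzero: it suffices that it
    moves some vector of the highest weight module to a nonzero one. *)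
Lemma km_eq_sound t u : km_eq D t u ->
  forall phi, hwmod D lam phi -> lie_act t phi = lie_act u phi.
Proof.
elim=> {t u}.
- by [].
- by move=> t u _ IH phi hp; rewrite IH.
- by move=> t u v _ IH _ IH' phi hp; rewrite IH // IH'.
- by move=> t t' u u' _ IH _ IH' phi hp; rewrite /= IH // IH'.
- by move=> a t t' _ IH phi hp /=; rewrite IH.
- move=> t t' u u' _ IH _ IH' phi hp /=.
  by rewrite (IH' _ hp) (IH _ hp) IH ?IH' //; exact: hwmod_lie_act.
- by move=> t u v phi hp; rewrite /= addrA.
- by move=> t u phi hp; rewrite /= addrC.
- by move=> t phi hp; rewrite /= add0r.
- by move=> t phi hp; rewrite /= scaleN1r addNr.
- by move=> a b t phi hp /=; rewrite scalerA.
- by move=> t phi hp /=; rewrite scale1r.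
- by move=> a t u phi hp /=; rewrite scalerDr.
- by move=> a b t phi hp /=; rewrite scalerDl.
- move=> t u v phi hp.
  exact: (congr1 (fun X : linop M => X phi) (brDl _ _ _)).
- move=> t u v phi hp.
  exact: (congr1 (fun X : linop M => X phi) (brDr _ _ _)).
- move=> a t u phi hp.
  exact: (congr1 (fun X : linop M => X phi) (linop_brZl _ _ _)).
- move=> a t u phi hp.
  exact: (congr1 (fun X : linop M => X phi) (linop_brZr _ _ _)).
- by move=> t phi hp /=; rewrite subrr.
- move=> t u v phi hp.
  change ((br (lie_act t) (br (lie_act u) (lie_act v)) +
    (br (lie_act u) (br (lie_act v) (lie_act t)) +
     br (lie_act v) (br (lie_act t) (lie_act u)))) phi = 0).
  by rewrite br_jacobi0.
- move=> a h h' phi hp.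
  exact: (congr1 (fun X : linop M => X phi) (opH_lin _ _ _ _ _)).
- move=> h h' phi hp; change (br (opH D lam h) (opH D lam h') phi = 0).
  by rewrite HH_comm.
- move=> h i phi hp.
  change (br (opH D lam h) (opE K i) phi =
    ev (sroot_in D K i) h *: opE K i phi).
  by rewrite linop_brE HE_apply addrC addKr.
- move=> h i phi hp.
  change (br (opH D lam h) (opF D lam i) phi =
    - ev (sroot_in D K i) h *: opF D lam i phi).
  by rewrite linop_brE HF_apply addrC addKr scaleNr.
- move=> i phi hp.
  change (br (opE K i) (opF D lam i) phi = opH D lam (scoroot_in D K i) phi).
  by rewrite br_EF eqxx.
- move=> i j ij phi hp; change (br (opE K i) (opF D lam j) phi = 0).
  by rewrite br_EF (negbTE ij).
- move=> i j ij phi hp; rewrite (lie_act_iter _ _ (x := opE K j)) //.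
  by have := serreE_hwmod ij hp; rewrite /serreE => ->.
- move=> i j ij phi hp; rewrite (lie_act_iterF _ _ (x := opF D lam j)) //.
  by have := @serreF_eq0 _ _ _ D lam i j ij; rewrite /serreF => ->.
Qed.

End KacMoodyAction.

(* Independence over Z passes to rat by clearing denominators, and then to K
   because the rank does not change under field extension. *)
Lemma intr_free_solve (K : numFieldType) (J : finType) (n : nat)
    (v : J -> 'rV[int]_n) (c : J -> K) :
  (forall m : J -> int, \sum_j m j *: v j = 0 -> forall j, m j = 0) ->
  exists x : 'cV[K]_n, forall j, ev (map_mx intr (v j)) x = c j.
Proof.
move=> vfree.
pose A (F : fieldType) : 'M[F]_(#|J|, n) :=
  \matrix_(i, j) (v (enum_val i) 0 j)%:~R.
have AQ : row_free (A rat).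
  rewrite -kermx_eq0; apply/eqP/row_matrixP => i0; rewrite row0.
  set q := row i0 _.
  have qA : q *m A rat = 0 by apply/sub_kermxP; exact: row_sub.
  pose d := \prod_(i < #|J|) denq (q 0 i).
  have dq i : {m : int | m%:~R = d%:~R * q 0 i}.
    exists ((\prod_(j < #|J| | j != i) denq (q 0 j)) * numq (q 0 i)).
    rewrite /d [in RHS](bigD1 i) //= !intrM numqE; ring.
  pose m j := sval (dq (enum_rank j)).
  have m0 : forall j, m j = 0.
    apply: vfree; apply/rowP => k; rewrite summxE mxE.
    apply: (@intr_inj rat); rewrite rmorph_sum /= rmorph0.
    have := congr1 (fun B : 'rV_n => d%:~R * B 0 k) qA.
    rewrite !mxE mulr0 => /(etrans _); apply.
    rewrite mulr_sumr (reindex_onto enum_val enum_rank) /=; last first.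
      by move=> ? _; exact: enum_rankK.
    apply: eq_big => [i|i _]; first by rewrite enum_valK eqxx.
    by rewrite mxE [A rat i k]mxE rmorphM /= /m enum_valK (svalP (dq i)) mulrA.
  have dn0 : d%:~R != 0 :> rat.
    by rewrite intr_eq0 prodf_seq_neq0; apply/allP => ? _; rewrite denq_eq0.
  apply/rowP => i; rewrite [RHS]mxE; apply/(mulfI dn0); rewrite mulr0.
  by rewrite -(svalP (dq i)); have := m0 (enum_val i); rewrite /m enum_valK => ->.
have freeK : row_free (A K).
  have -> : A K = map_mx ratr (A rat).
    by apply/matrixP => i j; rewrite !mxE ratr_int.
  by rewrite row_free_map.
have [B AB] := row_freeP freeK.
exists (B *m \col_i c (enum_val i)) => j.
have := congr1 (fun C => (C *m \col_i c (enum_val i)) (enum_rank j) 0) AB.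
rewrite -mulmxA mul1mx [RHS]mxE enum_rankK => <-.
rewrite /ev [LHS]mxE [RHS]mxE; apply: eq_bigr => k _; congr (_ * _).
by rewrite !mxE enum_rankK.
Qed.

Lemma coroot_prescribe (K : numFieldType) (I : finType) n (D : km_datum I n)
    (c : I -> K) :
  exists lam : 'rV[K]_n, forall i, ev lam (scoroot_in D K i) = c i.
Proof.
have [|x hx] := @intr_free_solve K I n (fun i => (scoroot D i)^T) c.
  move=> m hm; apply: (scoroot_free (k := D)); apply: trmx_inj.
  rewrite trmx0 -hm linear_sum; apply: eq_bigr => i _ /=.
  by rewrite linearZ.
exists x^T => i; rewrite -hx /ev -[in RHS](trmxK x) -map_trmx -trmx_mul.
by rewrite [RHS]mxE.
Qed.

Lemma root_prescribe (K : numFieldType) (I : finType) n (D : km_datum I n)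
    (c : I -> K) :
  exists v : 'cV[K]_n, forall i, ev (sroot_in D K i) v = c i.
Proof. by apply: intr_free_solve; exact: sroot_free. Qed.

(** * The simple roots and their opposites are roots *)

Section RealRoots.
Context (R : realType) (I : finType) (n : nat) (D : km_datum I n).

Lemma opE_opF_vac (K : numFieldType) (lam : 'rV[K]_n) i :
  opE K i (opF D lam i (@vac K I)) = ev lam (scoroot_in D K i) *: @vac K I.
Proof.
rewrite -(opH_vac D); have := br_EF D lam i i; rewrite eqxx => <-.
by rewrite linop_brE opE_vac linear0 subr0.
Qed.

Lemma vac_neq0 (K : numFieldType) : @vac K I <> 0.
Proof. by move/(congr1 (fun f => f [::])) => /eqP; rewrite oner_eq0. Qed.

(** When lam is 1 on every simple coroot, e_i f_i fixes the highest weight vector, so neither e_i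
    nor f_i acts by zero. *)
Lemma LE_neq0 i : ~ km_eq D (LE R n i) (LZero R I n).
Proof.
have [lam hlam] := coroot_prescribe D (fun=> 1 : R[i]).
move/(@km_eq_sound _ _ _ D lam)/(_ (opF D lam i (@vac _ I))).
move/(_ (hwmodF _ (hwmod_vac _ _))) => e.
have := opE_opF_vac lam i; rewrite hlam scale1r => e'.
by apply: (@vac_neq0 R[i]); rewrite -e'; exact: e.
Qed.

Lemma LF_neq0 i : ~ km_eq D (LF R n i) (LZero R I n).
Proof.
have [lam hlam] := coroot_prescribe D (fun=> 1 : R[i]).
move/(@km_eq_sound _ _ _ D lam)/(_ (@vac _ I)).
move/(_ (hwmod_vac _ _)) => e.
have := opE_opF_vac lam i; rewrite hlam scale1r => e'.
apply: (@vac_neq0 R[i]); rewrite -e'.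
have -> : opF D lam i (@vac R[i] I) = 0 by exact: e.
by rewrite linear0.
Qed.

Lemma sum_single (K : pzRingType) (V : lmodType K) (F : I -> V) i (c : int) :
  \sum_j (if j == i then c else 0)%:~R *: F j = c%:~R *: F i.
Proof.
rewrite (bigD1 i) //= eqxx big1 ?addr0 // => j /negbTE ->.
by rewrite scale0r.
Qed.

Lemma sgn_simple_root_Delta eps i : Delta D (sgn R eps *: alpha R D i).
Proof.
have al0 : alpha R D i != 0.
  apply/eqP => a0; have := ev_root_coroot R D i i.
  rewrite cartan_diag -/(alpha R D i) a0 /ev mul0mx mxE => /esym/eqP.
  by rewrite intr_eq0.
split.
  by rewrite scaler_eq0 negb_or al0 andbT; case: eps;
     rewrite /= ?oppr_eq0 oner_eq0.
exists (fun j => if j == i then (if eps then 1 else -1) else 0); split.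
  by rewrite sum_single; case: eps.
have sumE h : \sum_j (if j == i then (if eps then 1 else -1) else 0)%:~R *
     ev (sroot_in D R[i] j) h =
   (if eps then 1 else -1)%:~R * ev (sroot_in D R[i] i) h.
  exact: (@sum_single _ (R[i]^o) (fun j => ev (sroot_in D R[i] j) h)).
exists (if eps then LE R n i else LF R n i); split.
  by case: (eps); [exact: LE_neq0|exact: LF_neq0].
move=> h; rewrite sumE; case: (eps).
  by rewrite mul1r; exact: km_HE.
by rewrite mulN1r; exact: km_HF.
Qed.

End RealRoots.

(** * Weights of integrable modules *)

Section SL2.
Variables (K : numFieldType) (M : lmodType K) (e f h : linop M).
Hypotheses (ef : br e f = h) (he : br h e = e *~ 2) (hf : br h f = f *~ (-2)).

Lemma sl2_shift (x : linop M) (k : int) (c : K) (y : M) q :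
  br h x = x *~ k -> h y = c *: y ->
  h (iter q x y) = (c + (k * q%:Z)%:~R) *: iter q x y.
Proof.
move=> hx hy; elim: q => [|q IH] /=; first by rewrite mulr0 addr0.
have -> : h (x (iter q x y)) = br h x (iter q x y) + x (h (iter q x y)).
  by rewrite linop_brE subrK.
rewrite IH hx linopMzE linearZ /= -scaler_int -scalerDl; congr (_ *: _).
rewrite -addn1 PoszD mulrDr mulr1 intrD; ring.
Qed.

Lemma sl2_primitive (c : K) (y : M) q : e y = 0 -> h y = c *: y ->
  e (iter q.+1 f y) = (q.+1%:R * (c - q%:R)) *: iter q f y.
Proof.
move=> ey hy; have step z : e (f z) = h z + f (e z).
  by rewrite -ef linop_brE subrK.
elim: q => [|q IH]; first by rewrite /= step ey linear0 addr0 hy subr0 mul1r.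
rewrite iterS step IH (sl2_shift _ hf hy) linearZ /= -scalerDl; congr (_ *: _).
by rewrite intrM mulrNz; ring.
Qed.

Lemma sl2_primitive_neq0 (m : nat) (y : M) q : e y = 0 -> h y = m%:R *: y ->
  y <> 0 -> (q <= m)%N -> iter q f y <> 0.
Proof.
move=> ey hy y0; elim: q => [//|q IH] qm fy.
apply: (IH (ltnW qm)); have := sl2_primitive q ey hy; rewrite fy linear0.
move/esym/eqP; rewrite scaler_eq0 mulf_eq0 pnatr_eq0 /= subr_eq0 eqr_nat.
by rewrite (gtn_eqF qm) => /eqP.
Qed.

(** The last nonzero e^p y is primitive of weight m + 2p, so f^q does not kill it for q <= m + 2p;
    the power q = m + p lands in weight -m, the reflection of m. *)
Lemma sl2_string (m : nat) (y : M) N : h y = m%:R *: y -> y <> 0 ->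
  iter N e y = 0 -> exists p, iter (m + p) f (iter p e y) <> 0.
Proof.
move=> hy y0 hN.
have [p [ep epS]] : exists p, iter p e y <> 0 /\ iter p.+1 e y = 0.
  elim: N hN => [//|N IH] hN.
  by have [/IH//|hN0] := pselect (iter N e y = 0); exists N.
exists p; apply: (@sl2_primitive_neq0 (m + p.*2)%N) => //; last lia.
rewrite (sl2_shift _ he hy); congr (_ *: _).
by rewrite natrD; congr (_ + _); rewrite -[RHS]/((p.*2)%:Z%:~R); congr (_%:~R); lia.
Qed.

End SL2.

(** According to the sign of z, the string argument is run for (e, f, h) or for (f, e, -h). *)
Lemma sl2_reflect (K : numFieldType) (M : lmodType K) (e f h : linop M)
    (z : int) (y : M) N N' :
  br e f = h -> br h e = e *~ 2 -> br h f = f *~ (-2) ->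
  h y = z%:~R *: y -> y <> 0 -> iter N e y = 0 -> iter N' f y = 0 ->
  exists m p : nat, (z = m%:Z /\ iter (m + p) f (iter p e y) <> 0) \/
    (z = - m%:Z /\ iter (m + p) e (iter p f y) <> 0).
Proof.
move=> ef he hf; case: (intP z) => [|m|m] hy y0 hN hN'.
- have [p hp] := @sl2_string _ _ e f h ef he hf 0%N y N hy y0 hN.
  by exists 0%N, p; left.
- have [p hp] := @sl2_string _ _ e f h ef he hf m.+1 y N hy y0 hN.
  by exists m.+1, p; left.
have fe : br f e = - h by rewrite -ef -brC.
have hf' : br (- h) f = f *~ 2 by rewrite brNl hf mulrNz opprK.
have he' : br (- h) e = e *~ (-2) by rewrite brNl he mulrNz.
have hy' : (- h) y = m.+1%:R *: y by rewrite linopNE hy mulrNz scaleNr opprK.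
have [p hp] := sl2_string fe hf' he' hy' y0 hN'.
by exists m.+1, p; right.
Qed.

(** * Integrability and stability of the weights under reflections *)

Section Integrability.
Context (K : numFieldType) (I : finType) (n : nat) (D : km_datum I n).
Variable lam : 'rV[K]_n.
Hypothesis dom : forall i, exists m : nat, ev lam (scoroot_in D K i) = m%:R.

Local Notation al := (sroot_in D K).
Local Notation alv := (scoroot_in D K).
Local Notation M := (seq I -> K^o).
Local Notation E := (opE K).
Local Notation F := (opF D lam).
Local Notation H := (opH D lam).
Local Notation hw := (hwmod D lam).
Implicit Types phi : M.

Lemma iter_linear (V : lmodType K) (x : linop V) m (a : K) u v :
  iter m x (a *: u + v) = a *: iter m x u + iter m x v.
Proof. by elim: m => //= m ->; rewrite linearP. Qed.

Lemma iter_linop0 (V : lmodType K) (x : linop V) m : iter m x 0 = 0.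
Proof. by elim: m => //= m ->; rewrite linear0. Qed.

Lemma iter_eq0_le (V : lmodType K) (x : linop V) m m' u :
  (m <= m')%N -> iter m x u = 0 -> iter m' x u = 0.
Proof. by move=> /subnK <- e; rewrite iterD e iter_linop0. Qed.

(* Finite support is preserved by [F] because removing a letter shortens words
   by one. *)
Lemma hw_finsupp phi : hw phi ->
  exists d, forall w, (d <= size w)%N -> phi w = 0.
Proof.
elim=> [|k {}phi _ [d hd]|a {}phi psi _ [d hd] _ [d' hd']].
- by exists 1%N; case.
- exists d.+1 => w; elim: w phi d hd => [//|j w IH] phi d hd /= dw.
  case: d hd dw => [|d] hd dw.
    have -> : phi = 0 by apply/funext => u; exact: hd.
    by have /(congr1 (fun g => g (j :: w))) := linear0 (F k).
  change (F k (E j phi) w +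
    (if j == k then ev (weight D lam w) (alv k) * phi w else 0) = 0 :> K).
  rewrite (IH _ d) //; last by move=> u du; exact: hd.
  by case: eqP => _; rewrite ?addr0 // add0r hd ?mulr0.
- exists (maxn d d') => w; rewrite geq_max => /andP[dw dw'].
  change (a * phi w + psi w = 0 :> K).
  by rewrite hd // hd' // mulr0 addr0.
Qed.

Lemma hwE_nilp i phi : hw phi -> exists N, iter N (E i) phi = 0.
Proof.
move=> /hw_finsupp[d hd]; exists d; apply/funext => w.
have iterE N : forall phi w, iter N (E i) phi w = phi (nseq N i ++ w).
  elim: N => // N IH u v; rewrite iterSr IH.
  change (u (i :: (nseq N i ++ v)) = u (nseq N.+1 i ++ v)); by [].
by rewrite iterE hd // size_cat size_nseq leq_addr.
Qed.

(** Since x (z v) = [x, z] v + z (x v), each application of x lowers either m or N. *)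
Lemma nilp_adjoint (V : lmodType K) (x z : linop V) m N v :
  iter m (br x) z = 0 -> iter N x v = 0 -> iter (N + m) x (z v) = 0.
Proof.
elim: m z N v => [|m IH] z N v; first by move=> /= -> _; rewrite iter_linop0.
move=> hz; elim: N v => [|N IHN] v hv.
  by rewrite (hv : v = 0) linear0 iter_linop0.
rewrite iterSr in hv.
have -> : (N.+1 + m.+1 = (N + m.+1).+1)%N by [].
rewrite iterSr.
have -> : x (z v) = 1 *: br x z v + z (x v).
  by rewrite scale1r linop_brE subrK.
rewrite iter_linear IHN // addr0 scale1r addnS -addSn IH //.
  by rewrite -iterSr.
by rewrite iterSr.
Qed.

(** With m the value of lam at the i-th coroot, f_i^(m+1) sends the highest weight vector to a
    vector killed by every e_k: for k = i the sl2 coefficient contains m - m, and for k <> i the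
    operators e_k and f_i commute. By [cogen_eq0] this vector is 0. *)
Lemma hwF_vac_nilp i : exists N, iter N (F i) (@vac K I) = 0.
Proof.
have [m hm] := dom i; exists m.+1; apply: cogen_eq0; last exact: opF_nil.
move=> k; have [->|ki] := eqVneq k i.
  rewrite (@sl2_primitive _ _ (E i) (F i) (H (alv i)) _ _ m%:R).
  - by rewrite subrr mulr0 scale0r.
  - by rewrite br_EF eqxx.
  - by rewrite br_HF cartan_diag.
  - exact: opE_vac.
  - by rewrite opH_vac hm.
elim: (m.+1) => [|N IH]; first exact: opE_vac.
have := br_EF D lam i k; rewrite (negbTE ki).
move/(congr1 (fun X : linop M => X (iter N (F i) (@vac K I)))).
by rewrite linop_brE IH linear0 subr0.
Qed.

Lemma hwF_nilp i phi : hw phi -> exists N, iter N (F i) phi = 0.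
Proof.
elim=> [|k {}phi _ [N hN]|a {}phi psi _ [N hN] _ [N' hN']].
- exact: hwF_vac_nilp.
- have [m hm] : exists m, iter m (br (F i)) (F k) = 0.
    have [->|ik] := eqVneq i k; first by exists 1%N; rewrite /= brxx.
    by exists `|1 - cartan D i k|%N; exact: (serreF_eq0 D lam ik).
  by exists (N + m)%N; exact: nilp_adjoint.
- exists (maxn N N'); rewrite iter_linear.
  rewrite (iter_eq0_le _ hN) ?(iter_eq0_le _ hN') ?leq_max ?leqnn ?orbT //.
  by rewrite scaler0 addr0.
Qed.

Definition wt_vector (mu : 'rV[K]_n) phi := forall h, H h phi = ev mu h *: phi.

Definition is_weight (mu : 'rV[K]_n) :=
  exists phi, [/\ hw phi, phi <> 0 & wt_vector mu phi].

Lemma is_weight_lam : is_weight lam.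
Proof.
exists (@vac K I); split; [exact: hwmod_vac|exact: vac_neq0|].
by move=> h; rewrite opH_vac.
Qed.

Lemma wt_vectorE mu phi i q : wt_vector mu phi ->
  wt_vector (mu + q%:R *: al i) (iter q (E i) phi).
Proof.
move=> hp; elim: q => [|q IH] h; first by rewrite scale0r addr0.
rewrite iterS HE_apply IH linearZ /= -scalerDl; congr (_ *: _).
by rewrite !evDl !evZl; ring.
Qed.

Lemma wt_vectorF mu phi i q : wt_vector mu phi ->
  wt_vector (mu - q%:R *: al i) (iter q (F i) phi).
Proof.
move=> hp; elim: q => [|q IH] h; first by rewrite scale0r subr0.
rewrite iterS HF_apply IH linearZ /= -scalerBl; congr (_ *: _).
by rewrite !evDl !evNl !evZl; ring.
Qed.

Lemma ev_inj (a b : 'rV[K]_n) : (forall h, ev a h = ev b h) -> a = b.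
Proof.
move=> ab; apply/rowP => j; have := ab (delta_mx j 0).
by rewrite /ev -!colE !mxE.
Qed.

(** A weight vector is nonzero at some word w, where [opH h] multiplies by the value of [weight w]
    at h. Hence every weight is lam minus a sum of simple roots. *)
Lemma is_weight_word mu : is_weight mu -> exists w, mu = weight D lam w.
Proof.
move=> [phi [_ phi0 hp]].
have [w hw0] : exists w, phi w != 0.
  apply: contrapT => hn; apply: phi0; apply/funext => w.
  by apply/eqP/negPn/negP => h; apply: hn; exists w.
exists w; apply: ev_inj => h; apply: (mulIf hw0).
by have /(congr1 (fun g => g w))/esym := hp h.
Qed.

Lemma hw_iterE phi i q : hw phi -> hw (iter q (E i) phi).
Proof. by move=> hp; elim: q => //= q; exact: hwmodE. Qed.
Lemma hw_iterF phi i q : hw phi -> hw (iter q (F i) phi).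
Proof. by move=> hp; elim: q => //= q; exact: hwmodF. Qed.

Lemma is_weight_refl mu i : is_weight mu ->
  is_weight (mu - ev mu (alv i) *: al i).
Proof.
move=> wmu; have [z hz] : exists z : int, ev mu (alv i) = z%:~R.
  have [w ->] := is_weight_word wmu; elim: w => [|j w [z hz]].
    by have [m hm] := dom i; exists m; rewrite /weight big_nil subr0 hm.
  by exists (z - cartan D i j); rewrite weight_cons evDl evNl hz ev_root_coroot intrB.
have [phi [hp p0 hw]] := wmu; rewrite hz.
have EF : br (E i) (F i) = H (alv i) by rewrite br_EF eqxx.
have HE : br (H (alv i)) (E i) = E i *~ 2 by rewrite br_HE cartan_diag.
have HF : br (H (alv i)) (F i) = F i *~ (-2) by rewrite br_HF cartan_diag.
have hy : H (alv i) phi = z%:~R *: phi by rewrite hw hz.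
have [N hN] := hwE_nilp i hp; have [N' hN'] := hwF_nilp i hp.
have [m [p [[zm pn0]|[zm pn0]]]] := sl2_reflect EF HE HF hy p0 hN hN'.
  exists (iter (m + p) (F i) (iter p (E i) phi)); split; [|exact: pn0|].
    exact/hw_iterF/hw_iterE.
  have -> : mu - z%:~R *: al i = mu + p%:R *: al i - (m + p)%:R *: al i.
    by rewrite zm natrD scalerDl opprD addrACA subrr addr0.
  exact/wt_vectorF/wt_vectorE.
exists (iter (m + p) (E i) (iter p (F i) phi)); split; [|exact: pn0|].
  exact/hw_iterE/hw_iterF.
have -> : mu - z%:~R *: al i = mu - p%:R *: al i + (m + p)%:R *: al i.
  by rewrite zm mulrNz scaleNr opprK natrD scalerDl addrACA addNr addr0.
exact/wt_vectorE/wt_vectorF.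
Qed.

End Integrability.

(** * The fundamental chamber *)

Lemma nonneg_slope (R : realFieldType) (p q : R) :
  (forall s, 0 < s -> 0 <= p + s * q) -> 0 <= q.
Proof.
move=> h; rewrite leNgt; apply/negP => q0.
(* At this s the value p + s q is p - |p| - 1 < 0. *)
have s0 : 0 < (`|p| + 1) / - q by rewrite divr_gt0 ?oppr_gt0 // ltr_wpDl.
have := h _ s0; have -> : (`|p| + 1) / - q * q = - (`|p| + 1).
  by rewrite invrN mulrN mulNr divfK // lt_eqF.
by rewrite leNgt => /negP; apply; have := ler_norm p; lra.
Qed.

Section Topology.
Context (R : realType) (n : nat).
Implicit Types (a : 'rV[R]_n) (v c : 'cV[R]_n).

Lemma ev_bound a v e : (forall j, `|v j 0| <= e) ->
  `|ev a v| <= (\sum_j `|a 0 j|) * e.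
Proof.
move=> h; rewrite /ev mxE; apply: le_trans (ler_norm_sum _ _ _) _.
by rewrite mulr_suml; apply: ler_sum => j _; rewrite normrM ler_wpM2l.
Qed.

Lemma ev_continuous a : continuous (ev a : 'cV[R]_n -> R).
Proof.
move=> /= v B /= /(nbhs_ballP (ev a v))[e /= e0 eB].
pose s := \sum_j `|a 0 j|; have s0 : 0 <= s by exact: sumr_ge0.
have d0 : 0 < e / (1 + s) by rewrite divr_gt0 // ltr_wpDr.
apply/nbhs_ballP; exists (e / (1 + s)) => //= x [_ vx]; apply: eB => /=.
rewrite /ball /= -evNr -evDr.
apply: le_lt_trans (ev_bound (e := e / (1 + s)) _ _) _.
  by move=> j; rewrite !mxE ltW //; exact: vx.
rewrite -/s mulrA ltr_pdivrMr; last by rewrite ltr_wpDr.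
by rewrite mulrC ltr_pM2l //; lra.
Qed.

Lemma nbhs_line v c (B : set 'cV[R]_n) : nbhs v B ->
  exists2 r : R, 0 < r & forall t, 0 <= t < r -> B (v + t *: c).
Proof.
move=> /nbhs_normP[e /= e0 eB].
have c1 : 0 < 1 + `|c| by rewrite ltr_wpDr.
exists (e / (1 + `|c|)); first by rewrite divr_gt0.
move=> t /andP[t0 te]; apply: eB => /=.
rewrite opprD addNKr normrN normrZ ger0_norm //.
apply: le_lt_trans (_ : t * (1 + `|c|) < _); first by rewrite ler_wpM2l // lerDr.
by rewrite -ltr_pdivlMr.
Qed.

(* Equivalence of norms in finite dimension, by compactness of the unit
   sphere. *)
Lemma norm_small_nbhs (N : 'cV[R]_n -> R) (B : set 'cV[R]_n) : is_norm N ->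
  nbhs (0 : 'cV[R]_n) B -> exists2 d : R, 0 < d & forall v, N v < d -> B v.
Proof.
move=> [N0 Nd NZ ND] /nbhs_ballP[e /= e0 eB].
have coord_le (r : 'rV[R]_n) j : `|r 0 j| <= `|r|.
  by rewrite [leRHS]/Num.norm /= mx_normrE; apply/bigmax_geP; right; exists (0, j).
have N00 : N 0 = 0 by rewrite -(scale0r 0) NZ normr0 mul0r.
have NS (J : finType) (F : J -> 'cV[R]_n) : N (\sum_j F j) <= \sum_j N (F j).
  elim/big_ind2 : _ => [|x1 x2 y1 y2 h1 h2|//]; first by rewrite N00.
  by apply: le_trans (ND _ _) _; exact: lerD.
pose s := \sum_(j < n) N (delta_mx j 0).
have s0 : 0 <= s by exact: sumr_ge0.
have NC (r : 'rV[R]_n) : N r^T <= s * `|r|.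
  rewrite [r^T]matrix_sum_delta; apply: le_trans (NS _ _) _.
  rewrite mulr_suml; apply: ler_sum => j _; rewrite big_ord1 NZ mulrC mxE.
  by rewrite ler_wpM2l.
have NB u v : `|N u - N v| <= N (u - v).
  have NN w : N (- w) = N w by rewrite -scaleN1r NZ normrN1 mul1r.
  rewrite ler_norml lerBlDr -[X in N X <= _](subrK v) ND andbT.
  by rewrite lerNl opprB lerBlDr -[u - v]opprB NN -{1}[v](subrK u) ND.
pose S := [set r : 'rV[R]_n | `|r| = 1].
have cS : compact S.
  apply: bounded_closed_compact; first by exists 1; split => // x x1 r /= ->; exact: ltW.
  apply: (@closed_comp _ _ (fun r : 'rV[R]_n => `|r|) [set x | x = 1]).
    by move=> r _; exact: norm_continuous.
  exact: closed_eq.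
have cN : {within S, continuous (fun r : 'rV[R]_n => N r^T)}.
  apply: continuous_subspaceT => r /= U /= /(nbhs_ballP (N r^T))[d /= d0 dU].
  have : nbhs r [set x : 'rV[R]_n | U (N x^T)]; last by [].
  apply/nbhs_ballP; exists (d / (1 + s)); first by rewrite /= divr_gt0 // ltr_wpDr.
  move=> x /=; rewrite -ball_normE /= => hx; apply: dU; rewrite /ball /=.
  apply: le_lt_trans (NB _ _) _; rewrite -linearB.
  apply: le_lt_trans (NC _) _; move: hx.
  rewrite ltr_pdivlMr ?ltr_wpDr // => h; apply/le_lt_trans/h.
  by rewrite mulrC ler_wpM2l // lerDr.
(* The sphere is empty only when 0 is the sole vector, and any radius then works. *)
have [S0|/set0P/negP/negPn/eqP S0] := pselect (S !=set0); last first.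
  exists 1 => // v _; apply: eB; suff -> : v = 0 by exact: ballxx.
  apply/eqP/negPn/negP => v0.
  have vT0 : `|v^T| != 0 by rewrite normr_eq0 trmx_eq0.
  have : S (`|v^T|^-1 *: v^T) by rewrite /S /= normrZ normfV normr_id mulVf.
  by rewrite S0.
have [r0 /set_mem Sr0 hmin] := compact_EVT_min S0 cS cN.
have gr0 : 0 < N r0^T.
  rewrite lt_neqAle N0 andbT eq_sym; apply/eqP => /Nd /eqP; rewrite trmx_eq0 => /eqP r00.
  by move: Sr0; rewrite /S /= r00 normr0 => /eqP; rewrite eq_sym oner_eq0.
(* [N r0^T] is the minimum of N on the unit sphere, so by homogeneity N v is at least this minimum
   times the sup norm of v. *)
exists (e * N r0^T) => [|v hv]; first exact: mulr_gt0.
have vle : `|v^T| < e.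
  rewrite -(ltr_pM2r gr0); apply: le_lt_trans hv.
  have [->|v0] := eqVneq v 0; first by rewrite trmx0 normr0 mul0r.
  have vT0 : `|v^T| != 0 by rewrite normr_eq0 trmx_eq0.
  have Sv : S (`|v^T|^-1 *: v^T) by rewrite /S /= normrZ normfV normr_id mulVf.
  have := hmin _ (mem_set Sv); rewrite linearZ /= trmxK NZ normfV normr_id.
  by rewrite ler_pdivlMl // normr_gt0 trmx_eq0.
apply: eB; split => // i j; rewrite (ord1 j) mxE.
apply: le_lt_trans vle; rewrite sub0r normrN.
by have := coord_le v^T i; rewrite mxE.
Qed.

End Topology.

Section Chamber.
Context (R : realType) (I : finType) (n : nat) (D : km_datum I n).
Local Notation Cvf := (@Cvf R I n D).
Local Notation alpha := (alpha R D).

Lemma Cvf_nbhs v : Cvf v -> nbhs v Cvf.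
Proof.
move=> hv.
have hi i : \forall x \near v, 0 < ev (alpha i) x.
  have : nbhs (ev (alpha i) v) [set x | 0 < x].
    by apply: open_nbhs_nbhs; split; [exact: open_gt|exact: hv].
  exact: ev_continuous.
have F : Filter (nbhs v) by exact: nbhs_filter.
by have := @filter_forall _ _ _ (nbhs v) F hi.
Qed.

Lemma Cvf_nonempty : exists c, Cvf c.
Proof.
have [c hc] := root_prescribe D (fun=> 1 : R).
by exists c => i; rewrite [ev _ _]hc ltr01.
Qed.

Lemma closure_CvfP v : closure Cvf v <-> forall i, 0 <= ev (alpha i) v.
Proof.
split=> [hv i|hv B nB].
  have cl : closed [set x : 'cV[R]_n | 0 <= ev (alpha i) x].
    apply: (@closed_comp _ _ (ev (alpha i)) [set x | 0 <= x]).
      by move=> x _; exact: ev_continuous.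
    exact: closed_ge.
  have : closure [set x : 'cV[R]_n | 0 <= ev (alpha i) x] v.
    by apply: closure_subset hv => x /(_ i); exact: ltW.
  by rewrite -((closure_id _).1 cl).
have [c hc] := Cvf_nonempty; have [r r0 hr] := nbhs_line c nB.
exists (v + (r / 2) *: c); split; last by apply: hr; lra.
move=> i; rewrite evDr evZr ltr_wpDl // mulr_gt0 ?hc //; lra.
Qed.

Lemma closure_Cvf_D u v : closure Cvf u -> closure Cvf v -> closure Cvf (u + v).
Proof.
move=> /closure_CvfP hu /closure_CvfP hv; apply/closure_CvfP => i.
by rewrite evDr addr_ge0.
Qed.

Lemma closure_Cvf0 : closure Cvf 0.
Proof. by apply/closure_CvfP => i; rewrite /ev mulmx0 mxE. Qed.

Lemma Cvf_closureD u v : closure Cvf u -> Cvf v -> Cvf (u + v).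
Proof. by move=> /closure_CvfP hu hv i; rewrite evDr ltr_wpDl. Qed.

Lemma CvfZ (s : R) v : 0 < s -> Cvf v -> Cvf (s *: v).
Proof. by move=> s0 hv i; rewrite evZr mulr_gt0. Qed.

(** Every vector is a difference of two elements of the open chamber; this is what allows the apex
    of a sector to be changed. *)
Lemma Cvf_absorb v : exists2 c, Cvf c & Cvf (v + c).
Proof.
have [c hc] := root_prescribe D (fun i => `|ev (alpha i) v| + 1).
exists c => i; rewrite ?evDr [ev _ c]hc; first by rewrite ltr_wpDl.
by have := ler_norm (- ev (alpha i) v); rewrite normrN; lra.
Qed.

Lemma nonneg_closure a c : (forall x, Cvf x -> 0 <= ev a x) -> closure Cvf c ->
  0 <= ev a c.
Proof.
move=> h hc; have [x hx] := Cvf_nonempty.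
apply: (@nonneg_slope _ (ev a x)) => s s0.
rewrite -evZr -evDr addrC; apply: h; apply: Cvf_closureD => //.
by apply/closure_CvfP => i; rewrite evZr mulr_ge0 ?(ltW s0) // (closure_CvfP c).1.
Qed.

End Chamber.

(** * The Weyl group *)

Section WeylGroup.
Context (R : realType) (I : finType) (n : nat) (D : km_datum I n).
Local Notation weyl := (@weyl R I n D).
Local Notation refl := (refl R D).
Local Notation Cvf := (@Cvf R I n D).

Lemma mul_row_refl (mu : 'rV[R]_n) i :
  mu *m refl i = mu - ev mu (alphav R D i) *: alpha R D i.
Proof.
rewrite /refl mulmxBr mulmx1 mulmxA; congr (_ - _).
by rewrite [mu *m _]mx11_scalar mul_scalar_mx.
Qed.

Lemma ev_mulmx (mu : 'rV[R]_n) (w : 'M[R]_n) v : ev (mu *m w) v = ev mu (w *m v).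
Proof. by rewrite /ev mulmxA. Qed.

Lemma refl_invol i : refl i *m refl i = 1%:M.
Proof.
apply/row_matrixP => k; rewrite row_mul mul_row_refl.
have rk : row k (refl i) = row k 1%:M *m refl i by rewrite -row_mul mul1mx.
rewrite rk mul_row_refl evDl evNl evZl.
have -> : ev (alpha R D i) (alphav R D i) = 2.
  by rewrite [LHS]ev_root_coroot cartan_diag.
set c := ev _ _; rewrite -addrA -opprD -scalerDl.
by have -> : c + (c - c * 2) = 0 by [ring]; rewrite scale0r subr0.
Qed.

Lemma weyl_refl i : weyl (refl i).
Proof. by rewrite -[refl i]mulmx1; exact/weylM/weyl1. Qed.

Lemma weyl_mul w w' : weyl w -> weyl w' -> weyl (w *m w').
Proof.
by elim=> [|i {}w _ IH] h; rewrite ?mul1mx // -mulmxA; exact/weylM/IH.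
Qed.

Lemma weyl_inv w : weyl w ->
  exists w', [/\ weyl w', w' *m w = 1%:M & w *m w' = 1%:M].
Proof.
elim=> [|i {}w _ [w' [hw' e1 e2]]].
  by exists 1%:M; rewrite mulmx1; split => //; exact: weyl1.
exists (w' *m refl i); split; first exact/weyl_mul/weyl_refl.
- by rewrite mulmxA -(mulmxA w') refl_invol mulmx1.
- by rewrite mulmxA -(mulmxA _ w) e2 mulmx1 refl_invol.
Qed.

Lemma weyl_unit w : weyl w -> w \in unitmx.
Proof. by move=> /weyl_inv[w' [_ /mulmx1_unit[]]]. Qed.

Lemma invmx_unique (w w' : 'M[R]_n) : w' *m w = 1%:M -> invmx w = w'.
Proof.
move=> e; have [_ uw] := mulmx1_unit e.
by rewrite -[LHS]mul1mx -e -mulmxA mulmxV // mulmx1.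
Qed.

Definition dominant_integral (lam : 'rV[R]_n) :=
  forall i, exists m : nat, ev lam (scoroot_in D R i) = m%:R.

(** lam is a weight of its own module and weights are stable under simple reflections, so [lam *m w]
    is a weight too, hence lies below lam. *)
Lemma weyl_dominant lam w : dominant_integral lam -> weyl w ->
  exists u, lam *m w = weight D lam u.
Proof.
move=> dom hw; apply: (is_weight_word (D := D)).
have : is_weight D lam lam by exact: is_weight_lam.
(* Only the weight being moved is generalized; the highest weight of the module stays lam. *)
elim: hw {2 4}lam => [|i {}w _ IH] mu hmu; first by rewrite mulmx1.
rewrite mulmxA; apply: IH; rewrite mul_row_refl; exact: is_weight_refl.
Qed.

Lemma ev_weight_le lam u v : closure Cvf v -> ev (weight D lam u) v <= ev lam v.
Proof.
move=> /closure_CvfP hv; rewrite /weight evDl evNl gerDl oppr_le0.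
rewrite /ev mulmx_suml summxE; apply: sumr_ge0 => i _; exact: hv.
Qed.

Lemma ev_weight_eq lam u v : Cvf v -> ev (weight D lam u) v = ev lam v -> u = [::].
Proof.
move=> hv; case: u => // j u; rewrite weight_cons evDl evNl => e.
have := @ev_weight_le lam u v; rewrite -e.
have cv : closure Cvf v by apply: subset_closure.
by move=> /(_ cv); rewrite leNgt => /negP[]; rewrite gtrDl oppr_lt0; exact: hv.
Qed.

(* For [lam] dominant, [lam - lam w] and [lam - lam w^-1] are sums of simple
   roots; their values at [v] and at [w *m v] are opposite, so both vanish. *)
Lemma weyl_chamber_eq1 w v : weyl w -> Cvf v -> Cvf (w *m v) -> w = 1%:M.
Proof.
move=> hw hv hwv.
have dom_fix lam : dominant_integral lam -> lam *m w = lam.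
  move=> dom; have [u hu] := weyl_dominant dom hw.
  have [w' [hw' e1 e2]] := weyl_inv hw.
  have [u' hu'] := weyl_dominant dom hw'.
  have h1 : ev lam (w *m v) <= ev lam v.
    by rewrite -ev_mulmx hu; apply: ev_weight_le; exact: subset_closure.
  have h2 : ev lam v <= ev lam (w *m v).
    have -> : ev lam v = ev (lam *m w') (w *m v).
      by rewrite ev_mulmx mulmxA e1 mul1mx.
    by rewrite hu'; apply: ev_weight_le; exact: subset_closure.
  have u0 : u = [::].
    by apply: (ev_weight_eq hv (lam := lam)); rewrite -hu ev_mulmx; apply/le_anti/andP.
  by rewrite hu u0 /weight big_nil subr0.
have fund i : {om : 'rV[R]_n | forall j, ev om (scoroot_in D R j) = (j == i)%:R}.
  by apply: cid; exact: (coroot_prescribe D (fun j => (j == i)%:R)).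
pose om i := sval (fund i).
have omE i j : ev (om i) (scoroot_in D R j) = (j == i)%:R := svalP (fund i) j.
(* A form is a combination nu of the fundamental weights plus a form vanishing on the coroots; the
   latter is dominant with all values 0. *)
have all_fix (mu : 'rV[R]_n) : mu *m w = mu.
  pose nu := \sum_i ev mu (scoroot_in D R i) *: om i.
  rewrite -(subrK nu mu) mulmxDl; congr (_ + _).
    apply: dom_fix => i; exists 0%N; rewrite evDl evNl ev_suml.
    rewrite (bigD1 i) //= big1 => [|j ji]; rewrite evZl omE.
      by rewrite eqxx mulr1 addr0 subrr.
    by rewrite eq_sym (negbTE ji) mulr0.
  rewrite mulmx_suml; apply: eq_bigr => i _; rewrite -scalemxAl dom_fix //.
  by move=> j; exists (j == i).
by apply/row_matrixP => i; rewrite -[w in LHS]mul1mx row_mul all_fix.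
Qed.

End WeylGroup.

(** * The affine Weyl group and its action on walls *)

Section AffineWeyl.
Context (R : realType) (I : finType) (n : nat) (D : km_datum I n).
Local Notation weyl := (@weyl R I n D).
Local Notation corootlat := (@corootlat R I n D).
Local Notation Wa := (@Wa R I n D).

Lemma corootlat0 : corootlat 0.
Proof. by exists (fun=> 0); rewrite big1 // => i _; rewrite scale0r. Qed.

Lemma corootlatD q q' : corootlat q -> corootlat q' -> corootlat (q + q').
Proof.
move=> [m ->] [m' ->]; exists (fun i => m i + m' i).
by rewrite -big_split; apply: eq_bigr => i _; rewrite intrD scalerDl.
Qed.

Lemma corootlatN q : corootlat q -> corootlat (- q).
Proof.
move=> [m ->]; exists (fun i => - m i).
by rewrite -sumrN; apply: eq_bigr => i _; rewrite mulrNz scaleNr.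
Qed.

Lemma corootlat_int q i : corootlat q ->
  exists z : int, ev (alpha R D i) q = z%:~R.
Proof.
move=> [m ->]; exists (\sum_j m j * cartan D j i).
rewrite /ev mulmx_sumr summxE rmorph_sum; apply: eq_bigr => j _ /=.
by rewrite -scalemxAr mxE intrM -(ev_root_coroot R D).
Qed.

Lemma corootlat_weyl w q : weyl w -> corootlat q -> corootlat (w *m q).
Proof.
move=> hw hq; elim: hw => [|i {}w _ IH]; first by rewrite mul1mx.
rewrite -mulmxA; move: (w *m q) IH => {}q {}hq; have [z hz] := corootlat_int i hq.
rewrite /refl mulmxBl mul1mx -mulmxA; apply: corootlatD => //; apply: corootlatN.
rewrite [_ *m q]mx11_scalar -/(ev _ _) hz mul_mx_scalar.
exists (fun j => if j == i then z else 0).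
by rewrite (sum_single (alphav R D)).
Qed.

Lemma Wa_comp h h' : Wa h -> Wa h' -> Wa (fun v => h (h' v)).
Proof.
move=> [w [t [hw ht ->]]] [w' [t' [hw' ht' ->]]].
exists (w *m w'), (w *m t' + t); split; first exact: weyl_mul.
  by apply: corootlatD => //; exact: corootlat_weyl.
by apply/funext => v; rewrite mulmxDr mulmxA addrA.
Qed.

Lemma Wa_weyl w : weyl w -> Wa (fun v => w *m v).
Proof.
move=> hw; exists w, 0; split => //; first exact: corootlat0.
by apply/funext => v; rewrite addr0.
Qed.

Lemma Wa_inv h : Wa h -> exists h', [/\ Wa h', cancel h h' & cancel h' h].
Proof.
move=> [w [t [hw ht ->]]]; have [w' [hw' e1 e2]] := weyl_inv hw.
exists (fun v => w' *m v + w' *m (- t)); split.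
- by exists w', (w' *m (- t)); split => //; apply/corootlat_weyl/corootlatN.
- by move=> v; rewrite -mulmxDr addrK mulmxA e1 mul1mx.
- by move=> v; rewrite -mulmxDr mulmxA e2 mul1mx subrK.
Qed.

Lemma marked_walls_Wa w t p : weyl w -> corootlat t ->
  marked_walls D p -> marked_walls D ((fun v => w *m v + t) @` p.1, w *m p.2).
Proof.
case: p => X av hw ht [a [k [[w0 [i [hw0 -> eav]]] /= ->]]] /=.
have [w' [hw' e1 e2]] := weyl_inv hw; have [w0' [hw0' f1 f2]] := weyl_inv hw0.
(* The translation by t changes the constant of the wall by the value of alpha_i at this vector, an
   integer because the vector is in the coroot lattice. *)
have wt : corootlat (w0' *m (w' *m t)) by do 2 apply: corootlat_weyl => //.
have [z hz] := corootlat_int i wt.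
exists (alpha R D i *m invmx (w *m w0)), (k - z); split.
  exists (w *m w0), i; split => //; first exact: weyl_mul.
  by rewrite /= in eav *; rewrite eav mulmxA.
have -> : invmx (w *m w0) = w0' *m w'.
  by apply: invmx_unique; rewrite mulmxA -(mulmxA w0') e1 mulmx1.
have key y : ev (alpha R D i *m (w0' *m w')) y =
    ev (alpha R D i) (w0' *m (w' *m y)).
  by rewrite ev_mulmx mulmxA.
rewrite (invmx_unique f1) /wall; apply/seteqP; split => [_ [x /= hx <-]|y /= hy].
  rewrite key !mulmxDr (mulmxA w') e1 mul1mx evDr hz -[RHS]hx ev_mulmx intrB; ring.
exists (w' *m (y - t)) => /=; last by rewrite mulmxA e2 mul1mx subrK.
rewrite key in hy; rewrite ev_mulmx !mulmxBr evDr evNr hz -[RHS]hy intrB; ring.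
Qed.

Lemma Wa_vWeylAut h : Wa h -> vWeylAut D h.
Proof.
move=> [w [t [hw ht ->]]]; split; first by exists w, t; split => //; exact: I.
exists w, t; split => //; first exact: weyl_unit hw.
apply/seteqP; split=> [_ [p hp <-]|p hp]; first exact: marked_walls_Wa.
have [w' [hw' e1 e2]] := weyl_inv hw.
exists ((fun v => w' *m v + w' *m (- t)) @` p.1, w' *m p.2).
  by apply: marked_walls_Wa => //; apply/corootlat_weyl/corootlatN.
case: p {hp} => X av /=; rewrite mulmxA e2 mul1mx; congr pair.
rewrite image_comp; apply/seteqP; split => [_ [x hx <-]|x hx] /=.
  by rewrite -mulmxDr mulmxA e2 mul1mx subrK.
by exists x => //=; rewrite -mulmxDr mulmxA e2 mul1mx subrK.
Qed.

End AffineWeyl.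

(** * Germs in the model apartment *)

Section ModelGerms.
Context (R : realType) (I : finType) (n : nat) (D : km_datum I n) (eps : bool).
Local Notation Cvf := (@Cvf R I n D).
Local Notation alpha := (alpha R D).
Local Notation sg := (sgn R eps).
Local Notation pm := (@pm_infty R I n D eps).
Implicit Types (v c z : 'cV[R]_n) (E : set 'cV[R]_n).

Lemma sgnK v : sg *: (sg *: v) = v.
Proof. by rewrite scalerA /sgn; case: eps; rewrite ?mulr1 ?mulrNN ?mulr1 scale1r. Qed.

Lemma sgnM : sg * sg = 1.
Proof. by rewrite /sgn; case: eps; rewrite ?mulr1 ?mulrNN ?mulr1. Qed.

Lemma sector_face_germP w x E : weyl D w ->
  sector_face_germ x ((fun v => sg *: (w *m v)) @` Cvf) E <->
  exists z, forall c, Cvf c -> E (z + sg *: (w *m c)).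
Proof.
move=> hw; split=> [[u _ hE]|[z hE]].
  exists (x + u) => c hc; apply: hE; exists (sg *: (w *m c)) => //.
  by exists c.
have [w' [_ _ e2]] := weyl_inv hw.
have [c0 hc0 hc] := Cvf_absorb D (sg *: (w' *m (x - z))).
exists (sg *: (w *m c0)); first by apply: subset_closure; exists c0.
move=> _ [_ [c hc1 <-] <-].
have := hE _ (Cvf_closureD (subset_closure hc) hc1).
rewrite !(mulmxDr w) -scalemxAr mulmxA e2 mul1mx 2!scalerDr scalerA sgnM scale1r.
by rewrite 2!addrA (addrC z) subrK.
Qed.

Lemma vchamberE : (fun v => sg *: v) @` Cvf = (fun v => sg *: (1%:M *m v)) @` Cvf.
Proof. by apply: eq_imagel => v _; rewrite mul1mx. Qed.

Lemma pm_inftyP E : pm E <-> exists z, forall c, Cvf c -> E (z + sg *: c).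
Proof.
rewrite /pm_infty vchamberE (sector_face_germP 0 E (weyl1 R D)).
by split=> -[z hz]; exists z => c /hz; rewrite mul1mx.
Qed.

Lemma pm_inftyS E E' : E `<=` E' -> pm E -> pm E'.
Proof. by move=> EE' /pm_inftyP[z hz]; apply/pm_inftyP; exists z => c /hz /EE'. Qed.

Lemma pm_inftyI E E' : pm E -> pm E' -> pm (E `&` E').
Proof.
move=> /pm_inftyP[z hz] /pm_inftyP[z' hz']; apply/pm_inftyP.
have [c0 hc0 h0] := Cvf_absorb D (sg *: (z - z')).
exists (z + sg *: c0) => c hc; split.
  rewrite -addrA -scalerDr; apply: hz; apply: Cvf_closureD => //.
  exact: subset_closure.
have := hz' _ (Cvf_closureD (subset_closure h0) hc).
by rewrite 2!scalerDr sgnK 2!addrA (addrC z') subrK.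
Qed.

Lemma pm_infty_nonempty E : pm E -> exists v, E v.
Proof.
move=> /pm_inftyP[z hz]; have [c hc] := Cvf_nonempty R D.
by exists (z + sg *: c); exact: hz.
Qed.

Lemma pm_inftyT : pm setT.
Proof. by apply/pm_inftyP; exists 0. Qed.

Lemma pm_infty_agree E (P Q : set 'cV[R]_n) : pm E ->
  (forall v, E v -> P v <-> Q v) -> pm P <-> pm Q.
Proof.
move=> hE PQ; split=> h; apply: pm_inftyS (pm_inftyI hE h) => v [ev hv].
  by apply/(PQ v ev).
by apply/(PQ v ev).
Qed.

(** All roots vanish on this vectorial face. In (MA3) and (MA4), which concern faces, [face D v F0]
    plays the part of the point v. *)
Local Notation F0 := (@Fv R I n D [set: I]%SET).

Lemma Delta_sum a : Delta D a ->
  exists m : I -> int, a = \sum_i (m i)%:~R *: alpha i.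
Proof. by move=> [_ [m [am _]]]; exists m. Qed.

Lemma ev_Delta_F0 a v : Delta D a -> F0 v -> ev a v = 0.
Proof.
move=> /Delta_sum[m ->] hv; rewrite ev_suml big1 // => i _.
by rewrite evZl; have := hv i; rewrite finset.in_setT => ->; rewrite mulr0.
Qed.

Lemma F00 : F0 0.
Proof. by move=> i; rewrite finset.in_setT /ev mulmx0 mxE. Qed.

Lemma faceS v E E' : E `<=` E' -> face D v F0 E -> face D v F0 E'.
Proof.
move=> EE' [k [k' [/= PE ex]]]; exists k, k'; split => //.
exact: subset_trans EE'.
Qed.

Lemma face_mem v E : face D v F0 E -> E v.
Proof.
move=> [k [k' [/= PE [Om nO OP]]]]; apply: PE; apply: OP; split.
  exact: nbhs_singleton.
by exists 0; [exact: F00|rewrite addr0].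
Qed.

Lemma face_halfsp v k : (forall a, Delta D a -> halfsp a (k a) v) ->
  face D v F0 (\bigcap_(a in Delta D) halfsp a (k a)).
Proof.
move=> hk; exists k, (fun=> None); split=> /=.
  by move=> x hx a ha; have [] := hx a ha.
exists setT; first exact: filterT.
move=> _ [_ [y hy <-]] a ha; split => //; have := hk a ha.
by case: (k a) => //= K; rewrite evDr (ev_Delta_F0 ha hy) addr0.
Qed.

Lemma is_face_F0 v : is_face D (face D v F0).
Proof.
exists v, F0; split => //; exists true, 1%:M, [set: I]%SET; split; first exact: weyl1.
apply/seteqP; split => [x hx|_ [x hx <-]] /=; last by rewrite mul1mx scale1r.
by exists x => //; rewrite mul1mx scale1r.
Qed.

(** Only the roots [sg *: alpha i] are constrained, so these half-spaces cut out a closed sector of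
    sign [eps]. *)
Definition simple_bound (N : nat) (a : 'rV[R]_n) : option int :=
  if `[< exists i, a = sg *: alpha i >] then Some (- N%:Z) else None.

Lemma simple_boundP N v :
  (\bigcap_(a in Delta D) halfsp a (simple_bound N a)) v <->
  forall i, N%:R <= ev (alpha i) (sg *: v).
Proof.
rewrite /simple_bound; split=> [h i|h a ha].
  have := h _ (sgn_simple_root_Delta R D eps i).
  case: asboolP => [_|[]]; last by exists i.
  by rewrite /halfsp /= mulrNz subr_ge0 evZl evZr.
case: asboolP => [[i ->]|//]; rewrite /halfsp /= mulrNz subr_ge0 evZl -evZr.
exact: h.
Qed.

Lemma pm_infty_chimney :
  pm = chimney_germ D (face D 0 F0) ((fun v => sg *: v) @` Cvf).
Proof.
apply/seteqP; split => E.
  move=> /pm_inftyP[z hz].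
  (* An integral level strictly above z: the closed sector of level N then lies in the open sector
     with apex z. *)
  have [N hN] : exists N : nat, forall i, ev (alpha i) (sg *: z) < N%:R.
    exists (Num.bound (\sum_i `|ev (alpha i) (sg *: z)|)) => i.
    apply: le_lt_trans (archi_boundP _); last exact: sumr_ge0.
    apply: le_trans (ler_norm _) _.
    by rewrite (bigD1 i) //= lerDl sumr_ge0.
  (* Shifting by c0 raises the chimney to level N; the 1 keeps c0 in the open chamber when N = 0. *)
  have [c0 hc0] := root_prescribe D (fun=> N%:R + 1 : R).
  have c0C : Cvf c0 by move=> i; rewrite [ev _ _]hc0 ltr_wpDl.
  exists (sg *: c0); first by apply: subset_closure; exists c0.
  exists (simple_bound N); split; last first.
    move=> v /simple_boundP hv.
    have -> : v = z + sg *: (sg *: (v - z)) by rewrite sgnK addrC subrK.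
    apply: hz => i; rewrite scalerDr evDr scalerN evNr subr_gt0.
    exact: lt_le_trans (hN i) (hv i).
  exists (Defs.msum (\bigcap_(a in Delta D) halfsp a (simple_bound 0 a)) [set sg *: c0]).
    exists (\bigcap_(a in Delta D) halfsp a (simple_bound 0 a)) => //.
    apply: face_halfsp; apply/simple_boundP => i.
    by rewrite scaler0 /ev mulmx0 mxE.
  move=> _ [_ [_ [[x [_ [/simple_boundP hx -> ->]]] [c hc <-] ->]]].
  apply/simple_boundP => i; rewrite !scalerDr !sgnK !evDr.
  rewrite [ev _ c0]hc0; have := hx i; have := hc i; lra.
move=> [u _ [k [[E' [E0 hE0 hE'] hk] hE]]]; apply/pm_inftyP; exists u => c hc.
apply: hE; apply: hk; exists u, (sg *: c); split => //; last by exists c.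
by apply: hE'; exists 0, u; split => //; [exact: face_mem|rewrite add0r].
Qed.

Lemma tits_Cvf c : closure Cvf c -> tits D c.
Proof. by move=> hc; exists 1%:M, c; split => //; [exact: weyl1|rewrite mul1mx]. Qed.

Lemma splayed_pm : splayed_chimney_germ D pm.
Proof.
exists (face D 0 F0), ((fun v => sg *: v) @` Cvf); split.
- exact: is_face_F0.
- exists eps, 1%:M, finset.set0; split; first exact: weyl1.
  rewrite vchamberE; congr image; apply/seteqP; split=> v hv i.
    by rewrite finset.in_set0; exact: hv.
  by have := hv i; rewrite finset.in_set0.
- have [c hc] := Cvf_nonempty R D; exists (sg *: c); split; first by exists c.
  have ic : interior (tits D) c.
    apply: filterS (Cvf_nbhs hc) => x hx; exact/tits_Cvf/subset_closure.
  by rewrite /pm_int_tits /sgn /=; case: eps; [left|right];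
     rewrite ?scaleN1r ?opprK ?scale1r.
- exact: pm_infty_chimney.
Qed.

(** Preserving the germ forces the linear part w to send the open chamber into the closed one, then
    into the open one by a perturbation, and simple transitivity gives w = 1. *)
Lemma affW_germ_translation h : affW D setT h -> fmap h pm = pm ->
  exists t, h = fun v => v + t.
Proof.
move=> [w [t [hw _ ->]]] hpm; exists t.
suff -> : w = 1%:M by apply/funext => v; rewrite mul1mx.
have : pm [set v | Cvf (sg *: v)].
  by apply/pm_inftyP; exists 0 => c hc /=; rewrite add0r sgnK.
rewrite -hpm => /pm_inftyP[z hz] {hpm}.
have nn i c : Cvf c -> 0 <= ev (alpha i) (w *m c).
  move=> hc; apply: (@nonneg_slope _ (ev (alpha i) (sg *: (w *m z + t)))) => r r0.
  have := hz _ (CvfZ r0 hc) i; rewrite !mulmxDr -!scalemxAr => /ltW.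
  by rewrite addrAC scalerDr sgnK evDr (evZr r).
have [c hc] := Cvf_nonempty R D.
apply: (weyl_chamber_eq1 hw hc) => i.
have [w' [_ e1 e2]] := weyl_inv hw.
(* For small r the vector c - (r/2) w^-1 c is still in the chamber, so alpha_i(w c) >= (r/2)
   alpha_i(c) > 0. *)
have [r r0 hr] := nbhs_line (- (w' *m c)) (Cvf_nbhs hc).
have rr : 0 <= r / 2 < r by apply/andP; split; lra.
have := nn i _ (hr _ rr).
rewrite mulmxDr -scalemxAr mulmxN mulmxA e2 mul1mx scalerN evDr evNr evZr subr_ge0.
apply: lt_le_trans.
by rewrite mulr_gt0 ?hc //; lra.
Qed.

End ModelGerms.

(** * Charts adapted to a sector-germ *)

Section Charts.
Context (R : realType) (I : finType) (n : nat) (D : km_datum I n).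
Context (T : Type) (S : apartment_system R D T) (eps : bool).
Local Notation A := ('cV[R]_n).
Local Notation Cvf := (@Cvf R I n D).
Local Notation sg := (sgn R eps).
Local Notation pm := (@pm_infty R I n D eps).
Local Notation F0 := (@Fv R I n D [set: I]%SET).
Implicit Types (B : set T) (f : A -> T).

Lemma isomw_nonempty B : apt S B -> exists f, isomw S B f.
Proof.
move=> hB; have [f0 ->] := isomw_orbit hB.
exists f0, id => //; have := Wa_weyl (weyl1 R D).
by congr (Wa _ _); apply/funext => v; rewrite mul1mx.
Qed.

Lemma isomw_comp B f h : apt S B -> isomw S B f -> Wa D h ->
  isomw S B (fun v => f (h v)).
Proof.
move=> hB; have [f0 ->] := isomw_orbit hB => -[h0 hh0 ->] hh.
by exists (fun v => h0 (h v)) => //; exact: Wa_comp.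
Qed.

Lemma isomw_transitive B f f' : apt S B -> isomw S B f -> isomw S B f' ->
  exists2 h, Wa D h & forall v, f' v = f (h v).
Proof.
move=> hB; have [f0 ->] := isomw_orbit hB => -[h hh ->] [h' hh' ->].
have [h1 [hh1 k1 k2]] := Wa_inv hh.
by exists (fun v => h1 (h' v)); [exact: Wa_comp|move=> v; rewrite k2].
Qed.

Lemma isomw_model_iso B f : apt S B -> isomw S B f -> model_iso S B f.
Proof.
move=> hB hf f' hf'; have [h hh e] := isomw_transitive hB hf' hf.
by exists h => //; exact: Wa_vWeylAut.
Qed.

Lemma isomw_in B f v : apt S B -> isomw S B f -> B (f v).
Proof. by move=> hB hf; have [hfun _ _] := isomw_bij hB hf; exact: hfun. Qed.

Lemma isomw_inj B f : apt S B -> isomw S B f -> injective f.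
Proof.
move=> hB hf u v e; have [_ hinj _] := isomw_bij hB hf.
by apply: hinj; rewrite ?in_setT.
Qed.

Lemma isomw_surj B f x : apt S B -> isomw S B f -> B x -> exists v, f v = x.
Proof.
move=> hB hf Bx; have [_ _ hs] := isomw_bij hB hf.
by have [v _ <-] := hs x Bx; exists v.
Qed.

Lemma preimage_inj_image f (E : set A) : injective f -> f @^-1` (f @` E) = E.
Proof.
move=> hf; apply/seteqP; split=> [v [u hu /hf <-] //|v hv].
by exists v.
Qed.

Hypothesis hmasure : is_masure S.
Variable s : set_system T.

(* Isomorphisms in Isom^w(A, B) sending the sector-germ of sign [eps] at infinity
   to [s]; no other isomorphism is needed to compute x +_s u. *)
Definition chart B f := [/\ apt S B, isomw S B f & fmap f pm = s].

Lemma chart_inj B f : chart B f -> injective f.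
Proof. by move=> [hB hf _]; exact: isomw_inj hB hf. Qed.

Lemma chart_germ B f : chart B f -> s B.
Proof.
move=> [hB hf <-]; apply: (@pm_inftyS _ _ _ D eps setT (f @^-1` B)) => [v _|].
  exact: (isomw_in _ hB hf).
exact: pm_inftyT.
Qed.

Lemma chart_germE B f (E : set A) : chart B f -> s (f @` E) = pm E.
Proof.
move=> hc; have hi := chart_inj hc; case: hc => _ _ <-.
by rewrite /fmap /= preimage_inj_image.
Qed.

(** (MA2) for a point puts its enclosure in B', and the roots are constant on v + [F0], so every
    enclosing intersection belongs to the face. *)
Lemma face_in_apt B B' f v : apt S B -> isomw S B f -> apt S B' -> B' (f v) ->
  fmap f (face D v F0) B'.
Proof.
move=> hB hf hB' Bv.
have [|[E [k [/= kv kE]] EB] _] :=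
    MA2 hmasure (B := B) (B' := B') (f := f) (F := globally [set v]).
  split => //; first by apply: Or41; exists v.
  by move=> _ /= ->.
apply: (@faceS _ _ _ _ _ (\bigcap_(a in Delta D) halfsp a (k a))).
  by move=> x /kE Ex; have [] := EB (f x) (ex_intro2 _ _ x Ex erefl).
by apply: face_halfsp => a ha; exact: kv.
Qed.

Lemma splayed_germ B f : chart B f ->
  in_some_apt S (splayed_chimney_germ D) s.
Proof.
by move=> [hB hf <-]; exists B, f, pm; split => //; exact: splayed_pm.
Qed.

Lemma face_MA3 B f v : apt S B -> isomw S B f ->
  in_some_apt S (MA3_filter D) (fmap f (face D v F0)).
Proof.
by move=> hB hf; exists B, f, (face D v F0); split => //; left; exact: is_face_F0.
Qed.

(** A half-space containing v and a sector of the germ has nonnegative slope along the sector, so it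
    contains the closed cone issued from v. Thus the enclosure in (MA4) contains this cone. *)
Lemma MA4_point B B' f v : chart B f -> apt S B' -> s B' -> B' (f v) ->
  exists phi, [/\ weyl_iso S B B' phi,
    forall u, closure Cvf u -> phi (f (v + sg *: u)) = f (v + sg *: u) &
    pm [set x | phi (f x) = f x]].
Proof.
move=> hc hB' sB' Bv; have hi := chart_inj hc; have [hB hf _] := hc.
have hF := face_in_apt hB hf hB' Bv.
have [|phi [hphi [E [k [[E1 [E2 [sE1 FE2 kE12]]] kE]] hE]]] :=
    MA4 hmasure (B := B) (B' := B') (f := f) (Rg := s) (F := fmap f (face D v F0)).
  split => //; first by split; [exact: splayed_germ hc|exact: face_MA3 hB hf].
  split; first exact: chart_germ hc.
  exact: (face_in_apt hB hf hB (isomw_in v hB hf)).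
have E2v : E2 v.
  by apply: (@face_mem _ _ _ D); move: FE2; rewrite /pull /fmap /= preimage_inj_image.
have pE1 : pm E1 by rewrite -(chart_germE _ hc).
have vk : (\bigcap_(a in Delta D) halfsp a (k a)) v by rewrite kE12; right.
exists phi; split => //; last first.
  apply: pm_inftyS pE1 => x hx; apply/hE/kE; rewrite kE12; by left.
move=> u hu; apply/hE/kE => a ha; move: (vk a ha); case ka: (k a) => [K|//] /= va.
have [z hz] := (pm_inftyP _ _ _).1 pE1.
have nn : 0 <= ev (sg *: a) u.
  apply: (@nonneg_closure _ _ _ D) hu => c hcc; rewrite evZl -evZr.
  apply: (@nonneg_slope _ (ev a z + K%:~R)) => r r0.
  have : (\bigcap_(a in Delta D) halfsp a (k a)) (z + sg *: (r *: c)).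
    by rewrite kE12; left; apply: hz; exact: CvfZ.
  by move=> /(_ a ha); rewrite ka /= evDr !evZr mulrCA addrAC.
by rewrite evDr evZr -evZl addrAC addr_ge0.
Qed.

Hypothesis hs : sector_germ S eps s.

Lemma chart_exists : exists B f, chart B f.
Proof.
have [B [f [G [hB hf [x [V [[w [hw ->]] ->]]] es]]]] := hs.
exists B, (fun v => f (w *m v)); split => //.
  by apply: isomw_comp => //; exact: Wa_weyl.
rewrite es; apply/seteqP; split => E.
  move=> /pm_inftyP[z hz]; apply/(sector_face_germP _ _ _ hw).
  by exists (w *m z) => c /hz /=; rewrite mulmxDr -scalemxAr.
move=> /(sector_face_germP _ _ _ hw)[z hz]; apply/pm_inftyP.
have [w' [_ _ e2]] := weyl_inv hw.
exists (w' *m z) => c /hz /=.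
by rewrite /preimage /= mulmxDr mulmxA e2 mul1mx -scalemxAr.
Qed.

(** The isomorphism of (MA4) is the identity on an element of the germ, so it transports a chart to
    a chart. *)
Lemma chart_of_apt B' : apt S B' -> s B' -> exists f', chart B' f'.
Proof.
move=> hB' sB'; have [B [f hc]] := chart_exists.
have [v Bv] : exists v, B' (f v).
  by apply: (@pm_infty_nonempty _ _ _ D eps); case: hc sB' => _ _ <-.
have [phi [hphi _ hpm]] := MA4_point hc hB' sB' Bv.
have [f1 hf1] := isomw_nonempty hB'; have [hB hf fs] := hc.
have [h hh e] := hphi _ _ hf hf1.
exists (fun v => f1 (h v)); split => //; first exact: isomw_comp.
rewrite -fs; apply/seteqP; split => E /=.
  apply: (pm_infty_agree hpm _).1 => x /= <-; by rewrite /preimage /= e.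
apply: (pm_infty_agree hpm _).2 => x /= hx; by rewrite /preimage /= -e hx.
Qed.

Lemma chart_point x : exists B f v, chart B f /\ f v = x.
Proof.
have [B1 hB1 B1x] := apt_cover S x; have [f1 hf1] := isomw_nonempty hB1.
have [v1 fv1] := isomw_surj hB1 hf1 B1x.
have [B0 [g hc0]] := chart_exists.
have [|B [hB sB FB]] := MA3 hmasure (Rg := s) (F := fmap f1 (face D v1 F0)).
  by split; [exact: splayed_germ hc0|exact: face_MA3 hB1 hf1].
have [f hc] := chart_of_apt hB sB; have [_ hf _] := hc.
have Bx : B x by rewrite -fv1; exact: (face_mem FB).
by have [v fv] := isomw_surj hB hf Bx; exists B, f, v.
Qed.

(* This is the independence of x +_s u from the chart. *)
Lemma chart_ray B B' f f' v v' : chart B f -> chart B' f' -> f v = f' v' ->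
  forall u, closure Cvf u -> f (v + sg *: u) = f' (v' + sg *: u).
Proof.
move=> hc hc' fv; have [hB hf fs] := hc; have [hB' hf' fs'] := hc'.
have Bv : B' (f v) by rewrite fv; exact: (isomw_in _ hB' hf').
have [phi [hphi fixu hpm]] := MA4_point hc hB' (chart_germ hc') Bv.
have [h hh e] := hphi _ _ hf hf'.
have hi' := chart_inj hc'.
have hpmh : fmap h pm = pm.
  apply/seteqP; split => E.
    rewrite -(chart_germE _ hc') -fs => hE.
    apply: (pm_infty_agree hpm _).1 hE => x /= <-.
    by rewrite /preimage /= e; split => [hx|[y hy /hi' <-]//]; exists (h x).
  rewrite -(chart_germE _ hc') -fs => hE.
  apply: (pm_infty_agree hpm _).2 hE => x /= hx.
  by rewrite /preimage /= -hx e; split => [hx'|[y hy /hi' <-]//]; exists (h x).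
have [t ht] : exists t, h = fun x => x + t.
  by apply: affW_germ_translation hpmh; case: (Wa_vWeylAut hh).
have v't : v' = v + t.
  apply: hi'; rewrite -fv.
  have := fixu 0 (closure_Cvf0 D); rewrite scaler0 addr0 => <-.
  by rewrite e ht.
by move=> u hu; rewrite -fixu // e ht v't addrAC.
Qed.

(** An arbitrary isomorphism sending the germ at infinity to s differs from a chart by an
    automorphism preserving that germ, thus by a translation, which commutes with adding u. *)
Lemma translatedP x u y : translated S eps s x u y <->
  exists B f v, [/\ chart B f, f v = x & y = f (v + sg *: u)].
Proof.
split=> [[B [psi [v [[hB sB] hpsi psis <- ->]]]]|[B [f [v [hc <- ->]]]]].
  have [f hc] := chart_of_apt hB sB; have [_ hf _] := hc.
  have hi := chart_inj hc.
  have [h [hh _] e] := hpsi f hf.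
  have hpmh : fmap h pm = pm.
    apply/seteqP; split => E.
      rewrite -(chart_germE _ hc) -psis => hE; rewrite /fmap /=.
      by apply: pm_inftyS hE => b hb; rewrite /preimage /= e; exists (h b).
    rewrite -(chart_germE _ hc) -psis => hE; rewrite /fmap /=.
    by apply: pm_inftyS hE => b; rewrite /preimage /= e => -[z hz /hi <-].
  have [t ht] := affW_germ_translation hh hpmh.
  by exists B, f, (v + t); split; rewrite // e ht // addrAC.
have [hB hf fs] := hc; exists B, f, v; split => //.
  by split => //; exact: chart_germ hc.
exact: isomw_model_iso.
Qed.

Lemma UsetP B B' f f' v v' (p : A * A) : chart B f -> chart B' f' ->
  Uset S eps s (f v) (f' v') p <->
  [/\ closure Cvf p.1, closure Cvf p.2 &
      f (v + sg *: p.1) = f' (v' + sg *: p.2)].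
Proof.
move=> hc hc'; split=> [[h1 h2 [y [/translatedP[B1 [g [b [hg gb ->]]]]]]]|[h1 h2 e]].
  move=> /translatedP[B2 [g' [b' [hg' gb' e]]]]; split => //.
  by rewrite -(chart_ray hg hc gb h1) e (chart_ray hg' hc' gb' h2).
split => //; exists (f (v + sg *: p.1)); split; apply/translatedP.
  by exists B, f, v.
by exists B', f', v'; split.
Qed.

Lemma Uset_nonempty x x' : exists p, Uset S eps s x x' p.
Proof.
have [B [f [v [hc <-]]]] := chart_point x.
have [B' [f' [v' [hc' <-]]]] := chart_point x'.
(* A point common to both apartments, deep in the germ; both translates are then taken to the point
   sg (c1 + c2) beyond it. *)
have [a Ba] : exists a, B' (f a).
  apply: (@pm_infty_nonempty _ _ _ D eps).
  by have := chart_germ hc'; case: hc => _ _ <-.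
have [hB' hf' _] := hc'; have [a' fa'] := isomw_surj hB' hf' Ba.
have [c1 hc1 hv] := Cvf_absorb D (sg *: (a - v)).
have [c2 hc2 hv'] := Cvf_absorb D (sg *: (a' - v')).
have sub := @subset_closure _ Cvf.
exists (sg *: (a - v) + (c1 + c2), sg *: (a' - v') + (c1 + c2)).
apply/(UsetP _ _ _ hc hc') => /=; split.
- by rewrite addrA; apply: closure_Cvf_D; exact: sub.
- by rewrite addrCA; apply: closure_Cvf_D; exact: sub.
have shift (x1 x2 w : A) : x2 + sg *: (sg *: (x1 - x2) + w) = x1 + sg *: w.
  by rewrite scalerDr sgnK addrA (addrC x2) subrK.
rewrite !shift; apply: (chart_ray hc hc') => //.
by apply: closure_Cvf_D; exact: sub.
Qed.

Lemma Uset_sym x x' p : Uset S eps s x x' p -> Uset S eps s x' x (p.2, p.1).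
Proof. by move=> [h1 h2 [y [t1 t2]]]; split => //; exists y. Qed.

Lemma Uset0 x : Uset S eps s x x (0, 0).
Proof.
have [B [f [v [hc <-]]]] := chart_point x.
by apply/(UsetP _ _ _ hc hc); split => //; exact: closure_Cvf0.
Qed.

(** Translations commute: x + p.1 + q.1 = y + p.2 + q.1 = y + q.1 + p.2 = z + q.2 + p.2. *)
Lemma Uset_comp x y z p q : Uset S eps s x y p -> Uset S eps s y z q ->
  Uset S eps s x z (p.1 + q.1, q.2 + p.2).
Proof.
have [B [f [a [hf <-]]]] := chart_point x.
have [B1 [g [b [hg <-]]]] := chart_point y.
have [B2 [h [c [hh <-]]]] := chart_point z.
move=> /(UsetP _ _ _ hf hg)[p1 p2 e] /(UsetP _ _ _ hg hh)[q1 q2 e'].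
apply/(UsetP _ _ _ hf hh) => /=; split; [exact: closure_Cvf_D..|].
rewrite !scalerDr !addrA (chart_ray hf hg e q1) -(chart_ray hg hh e' p2).
by rewrite addrAC.
Qed.

(* (MA2) applies to germs of segments that are open at their origin, and the
   enclosure of such a germ contains the origin. *)
Lemma open_segment_closed B B' f v c : apt S B -> isomw S B f -> apt S B' ->
  Cvf c -> (forall t, 0 < t -> B' (f (v + sg *: (t *: c)))) -> B' (f v).
Proof.
(* c = 0 lies in the chamber when [I] is empty, and then spans no segment. *)
move=> hB hf hB' hc ht; have [c0|/eqP c0] := eqVneq c 0.
  by have := ht 1 ltr01; rewrite c0 !scaler0 addr0.
have sc0 : sg *: c <> 0 by move=> e; apply: c0; rewrite -(sgnK eps c) e scaler0.
pose y := v + sg *: c.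
have yv : y - v = sg *: c by rewrite /y addrAC subrr add0r.
pose F := within (segment v y `\ v) (nbhs v).
have [|[E [k [/= Fk kE]] EB] _] :=
    MA2 hmasure (B := B) (B' := B') (f := f) (F := F).
  split => //.
    apply: Or42; exists v, y; split.
    - by move=> e; apply: sc0; rewrite -yv -e subrr.
    - rewrite /leT yv -[v - y]opprB yv /sgn; case: (eps); [left|right].
        by rewrite scale1r; apply: tits_Cvf; exact: subset_closure.
      by rewrite scaleN1r opprK; apply: tits_Cvf; exact: subset_closure.
    - by right.
  rewrite /fmap /F /within /=; near=> x => -[[t [/andP[t0 t1] ->]] /= tv].
  rewrite yv scalerA mulrC -scalerA; apply: ht.
  rewrite lt_neqAle t0 andbT eq_sym; apply/eqP => t00; apply: tv.
  by rewrite t00 scale0r addr0.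
suff Ev : E v by have [] := EB (f v) (ex_intro2 _ _ v Ev erefl).
have [r r0 hr] := nbhs_line (sg *: c) Fk.
apply: kE => a ha.
have hka t : 0 < t -> t < r -> t <= 1 -> halfsp a (k a) (v + t *: (sg *: c)).
  move=> t0 tr t1; apply: (hr t) => //; first by rewrite (ltW t0).
  split; first by exists t; rewrite (ltW t0) t1 yv.
  move=> /= e; apply: sc0; move/eqP: e; rewrite -subr_eq0 addrAC subrr add0r.
  by rewrite scaler_eq0 gt_eqF //= => /eqP.
move: hka; case: (k a) => [K|//] /= hka.
(* The limit t -> 0 is taken with t = 1/(q + m): m ensures t < r and t <= 1, and multiplying by q +
   m makes the inequality affine in q with slope [ev a v + K%:~R]. *)
pose m := r^-1 + 1; have m0 : 0 < m by rewrite addr_gt0 // invr_gt0.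
apply: (@nonneg_slope _ (ev a (sg *: c) + m * (ev a v + K%:~R))) => q q0.
have qm : 0 < q + m by exact: addr_gt0.
have := hka (q + m)^-1; rewrite invr_gt0 => /(_ qm).
have -> : (q + m)^-1 < r.
  by rewrite -[r]invrK ltf_pV2 ?posrE ?invr_gt0 // /m addrCA ltrDl addr_gt0.
have -> : (q + m)^-1 <= 1.
  rewrite -[1]invr1 lef_pV2 ?posrE // /m addrA lerDr addr_ge0 ?(ltW q0) //.
  by rewrite invr_ge0 ltW.
move=> /(_ isT isT); rewrite evDr evZr -(pmulr_rge0 _ qm).
by congr (0 <= _); field; rewrite gt_eqF.
Unshelve. all: by end_near. Qed.

End Charts.

(** * The distance *)

Lemma is_norm0 (R : realType) n (N : 'cV[R]_n -> R) : is_norm N -> N 0 = 0.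
Proof. by move=> [_ _ NZ _]; rewrite -(scale0r 0) NZ normr0 mul0r. Qed.

Section Distance.
Context (R : realType) (I : finType) (n : nat) (D : km_datum I n).
Context (T : Type) (S : apartment_system R D T) (eps : bool).
Variables (s : set_system T) (N : 'cV[R]_n -> R).
Hypotheses (hmasure : is_masure S) (hs : sector_germ S eps s).
Hypothesis hN : is_norm N.
Local Notation U := (Uset S eps s).
Local Notation d := (dtheta S N eps s).
Local Notation sg := (sgn R eps).
Local Notation Cvf := (@Cvf R I n D).

Lemma dtheta_le x x' p : U x x' p -> d x x' <= N p.1 + N p.2.
Proof.
move=> hp; apply: ge_inf; last by exists p.
by exists 0 => _ [q _ <-]; have [N0 _ _ _] := hN; rewrite addr_ge0.
Qed.

Lemma dtheta_glb x x' r : (forall p, U x x' p -> r <= N p.1 + N p.2) ->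
  r <= d x x'.
Proof.
move=> h; apply: lb_le_inf => [|_ [q hq <-]]; last exact: h.
by have [p hp] := Uset_nonempty hmasure hs x x'; exists (N p.1 + N p.2), p.
Qed.

Lemma dtheta_ge0 x x' : 0 <= d x x'.
Proof. by apply: dtheta_glb => p _; have [N0 _ _ _] := hN; rewrite addr_ge0. Qed.

Lemma dtheta_approx x x' r : d x x' < r ->
  exists2 p, U x x' p & N p.1 + N p.2 < r.
Proof.
move=> dr; apply: contrapT => h; move: dr; rewrite ltNge => /negP; apply.
apply: dtheta_glb => p hp; rewrite leNgt; apply/negP => pr.
by apply: h; exists p.
Qed.

Lemma dtheta_sym x x' : d x x' = d x' x.
Proof.
suff le y y' : d y y' <= d y' y by apply/le_anti; rewrite !le.
by apply: dtheta_glb => p hp; rewrite addrC; exact: (dtheta_le (Uset_sym hp)).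
Qed.

Lemma dtheta_xx x : d x x = 0.
Proof.
apply/le_anti; rewrite dtheta_ge0 andbT.
by have := dtheta_le (Uset0 hmasure hs x); rewrite is_norm0 // addr0.
Qed.

Lemma dtheta_triangle x y z : d x z <= d x y + d y z.
Proof.
have [_ _ _ ND] := hN.
rewrite -lerBlDl; apply: dtheta_glb => q hq; rewrite lerBlDl -lerBlDr.
apply: dtheta_glb => p hp; rewrite lerBlDr.
apply: le_trans (dtheta_le (Uset_comp hmasure hs hp hq)) _.
apply: le_trans (lerD (ND _ _) (ND _ _)) _ => /=; lra.
Qed.

Lemma dtheta_eq0 x x' : d x x' = 0 -> x = x'.
Proof.
have [N0 Nd NZ ND] := hN.
have [B [f [v [hc <-]]]] := chart_point hmasure hs x.
have [B' [f' [v' [hc' <-]]]] := chart_point hmasure hs x'.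
move=> d0; have hi' := chart_inj hc'; have UP p := UsetP hmasure hs v v' p hc hc'.
(* The translation from one chart to the other does not depend on the element
   of [U], and its norm is a lower bound of the infimum. *)
have Udiag p : U (f v) (f' v') p -> p.1 = p.2.
  move=> hp; have [p1 p2 ep] := (UP p).1 hp.
  suff h : N (p.2 - p.1) <= d (f v) (f' v').
    apply/esym/eqP; rewrite -subr_eq0; apply/eqP/Nd/le_anti.
    by rewrite N0 andbT -d0.
  apply: dtheta_glb => q hq; have [q1 q2 eqq] := (UP q).1 hq.
  suff -> : p.2 - p.1 = q.2 - q.1.
    apply: le_trans (ND _ _) _.
    by rewrite -scaleN1r NZ normrN1 mul1r addrC.
  have := chart_ray hmasure hc hc' ep q1.
  rewrite -addrA -scalerDr (addrC p.1) scalerDr addrA.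
  rewrite (chart_ray hmasure hc hc' eqq p1) => /hi'.
  rewrite -!addrA => /addrI; rewrite -!scalerDr.
  move=> /(congr1 ( *:%R sg)); rewrite !sgnK => e.
  by apply/eqP; rewrite subr_eq addrAC eq_sym subr_eq e addrC.
have [c hcC] := Cvf_nonempty R D.
have agree t : 0 < t -> f (v + sg *: (t *: c)) = f' (v' + sg *: (t *: c)).
  (* For u small enough, t c - u is in the chamber, so the common ray starting at v + sg u reaches v
     + sg t c. *)
  move=> t0; have [|r r0 hr] := norm_small_nbhs (B := [set u | Cvf (t *: c - u)]) hN.
    have : nbhs (t *: c) Cvf by apply: Cvf_nbhs; exact: CvfZ.
    move=> /nbhs_ballP[e /= e0 eB]; apply/nbhs_ballP; exists e => //= u [_ hu].
    apply: eB; split => // i j; have := hu i j.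
    rewrite /ball /= !mxE sub0r normrN => hij.
    by rewrite opprB addrC subrK.
  have [[u u'] hu] : exists2 p, U (f v) (f' v') p & N p.1 + N p.2 < r.
    by apply: dtheta_approx; rewrite d0.
  have /= uu' := Udiag _ hu; rewrite -{u'}uu' in hu * => /= Nu.
  have /hr /= hw : N u < r by apply: le_lt_trans Nu; rewrite lerDl.
  have [/= u1 _ eu] := (UP _).1 hu.
  have := chart_ray hmasure hc hc' eu (subset_closure hw).
  by rewrite -!addrA -!scalerDr (addrC u) subrK.
have [hB hf _] := hc; have [hB' hf' _] := hc'.
have Bv : B' (f v).
  apply: (open_segment_closed (eps := eps) hmasure hB hf hB' hcC) => t t0.
  by rewrite agree //; exact: (isomw_in _ hB' hf').
have [b fb] := isomw_surj hB' hf' Bv.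
(* With f' b = f v, the rays from b and from v' agree at c, and injectivity of f' gives b = v'. *)
have := chart_ray hmasure hc' hc fb (subset_closure hcC).
rewrite -[c]scale1r agree // => /hi' /addIr e.
by rewrite -fb e.
Qed.

End Distance.

Theorem mainTheorem6 (R : realType) (I : finType) (n : nat) (D : km_datum I n)
    (T : Type) (S : apartment_system R D T)
    (G : groupType) (act : G -> T -> T)
    (A0 : set T) (f0 : 'cV[R]_n -> T)
    (hmasure : is_masure S)
    (hthick : thick_finite S)
    (htrans : strongly_transitive S act)
    (hA0 : apt S A0) (hf0 : isomw S A0 f0)
    (hstab : stabilizer_induces act A0 f0 (affW D (@Ylat R n)))
    (N : 'cV[R]_n -> R) (hN : is_norm N)
    (eps : bool) (s : set_system T) (hs : sector_germ S eps s) :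
  is_distance (dtheta S N eps s).
Proof.
split=> [x y|x y|x y|x y z].
- exact: dtheta_ge0.
- by split=> [|->]; [exact: dtheta_eq0|exact: dtheta_xx].
- exact: dtheta_sym.
- exact: dtheta_triangle.
Qed.
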